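(* Assume the Furstenberg-Kesten condition and the generalized boundary case condition. Then there exist constants $c,C>0$ such that, for all $x,y\in\mathbb S_+^{d-1}$, $t\in\mathbb R$ and $a\ge0$, $$c\,\mathbb E_{\mathbb Q_y^{\alpha,*}}\Big[\sum_{j=0}^\infty\mathbf 1_{[t+c_1,t+a-c_1]}(S^*_{T_j^+})\Big]\le\mathbb E_{\mathbb Q_x^\alpha}\Big[\sum_{n=0}^{\tau_{c_1}^--1}\mathbf 1_{[t,t+a]}(S_n)\Big],$$ $$\mathbb E_{\mathbb Q_x^\alpha}\Big[\sum_{n=0}^{\tau_{-c_1}^--1}\mathbf 1_{[t,t+a]}(S_n)\Big]\le C\,\mathbb E_{\mathbb Q_y^{\alpha,*}}\Big[\sum_{j=0}^\infty\mathbf 1_{[t-c_1,t+a+c_1]}(S^*_{T_j^+})\Big],$$ as well as $$c\,\mathbb E_{\mathbb Q_y^{\alpha,*}}\Big[\sum_{j=0}^\infty\mathbf 1_{[t+c_1,t+a-c_1]}(-S^*_{T_j^-})\Big]\le\mathbb E_{\mathbb Q_x^\alpha}\Big[\sum_{n=0}^{\tau_{c_1}^+-1}\mathbf 1_{[t,t+a]}(-S_n)\Big],$$ $$\mathbb E_{\mathbb Q_x^\alpha}\Big[\sum_{n=0}^{\tau_{-c_1}^+-1}\mathbf 1_{[t,t+a]}(-S_n)\Big]\le C\,\mathbb E_{\mathbb Q_y^{\alpha,*}}\Big[\sum_{j=0}^\infty\mathbf 1_{[t-c_1,t+a+c_1]}(-S^*_{T_j^-})\Big].$$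
   Context: Matrices. On $\mathbb R^d$ use $\|v\|=\sum_{i=1}^d|v_i|$; $\mathbb S_+^{d-1}=\{v\in\mathbb R_+^d:\|v\|=1\}$. A nonnegative $d\times d$ matrix is allowable if every row and every column has a strictly positive entry; $\mathbb M$ is the semigroup of allowable matrices. $\|g\|=\sup_{x\in\mathbb S_+^{d-1}}\|gx\|$, $g\cdot x=gx/\|gx\|$, $\sigma(g,x)=\log\|gx\|$, $g^*$ is the transpose of $g$. Matrix branching random walk. $\mathscr N$ is a point process on $\mathbb M$, $N=\mathscr N(\mathbb M)$ ($N\equiv1$ is the non-branching case of products of i.i.d. matrices). Each node $u$ of the Ulam-Harris tree carries an i.i.d. copy $\mathscr N_u=\sum_{j=1}^{N_u}\delta_{g_{uj}}$ of $\mathscr N$; $\mathbb T$ is the random tree with root $\emptyset$ in which $u$ has children $uj$, $1\le j\le N_u$. $|u|$ is the generation of $u$, $u|k$ its ancestor in generation $k$, and $G_u=g_ug_{u|n-1}\cdots g_{u|1}$ for $|u|=n$. Sums over $|u|=n$ run over $u\in\mathbb T$. Under $\mathbb P_x$, $X_\emptyset=x\in\mathbb S_+^{d-1}$, $S_\emptyset=0$, and $X_u=G_u\cdot X_\emptyset$, $S_u=S_\emptyset-\log\|G_uX_\emptyset\|$. Transfer operators. $I=\{s\ge 0:\mathbb E\sum_{|u|=1}\|G_u\|^s<\infty\}$, with interior $I^\circ$. For $s\in I$, $P_s\varphi(x)=\mathbb E\sum_{|u|=1}e^{s\sigma(G_u,x)}\varphi(G_u\cdot x)$ and $P_s^*\varphi(x)=\mathbb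 E\sum_{|u|=1}e^{s\sigma(G_u^*,x)}\varphi(G_u^*\cdot x)$ on continuous functions on $\mathbb S_+^{d-1}$. They have the same spectral radius $\mathfrak m(s)$ (differentiable on $I^\circ$), and $r_s,r_s^*$ are their strictly positive continuous eigenfunctions (scalings fixed): $P_sr_s=\mathfrak m(s)r_s$, $P_s^*r_s^*=\mathfrak m(s)r_s^*$. Conditions. $\Gamma$ is the smallest closed subsemigroup of the nonnegative $d\times d$ matrices containing $\{G_u:|u|=1\}$ with probability 1. Furstenberg-Kesten: there is $\varkappa>1$ such that every $g=(g^{i,j})\in\Gamma$ has all entries strictly positive and $\max_{i,j}g^{i,j}\le\varkappa\min_{i,j}g^{i,j}$. Generalized boundary case: either $N\equiv1$ a.s. or $\mathbb E N>1$; in addition there is $\alpha\in I^\circ$ with $\mathfrak m(\alpha)=1$, $\mathfrak m'(\alpha)=0$ (this fixes $\alpha$). Constants: under the Furstenberg-Kesten condition there is a constant $c_0>0$ (fixed) with $|\log\|gx\|-\log\|gx'\||\le c_0$ for all $g\in\Gamma$, $x,x'\in\mathbb S_+^{d-1}$; set $c_1=c_0+2\log\varkappa+\log d$. Original walk. $\mathbb Q_x^\alpha$ is the law of a sequence $(g_i)_{i\ge1}$ of matrices together with $X_0=x$, $S_0=0$ such that for all $n\ge1$ and bounded measurable $f$, $\mathbb E_{\mathbb Q_x^\alpha}f(g_1,\dots,g_n)=\frac1{r_\alpha(x)}\mathbb E_x[\sum_{|u|=n}e^{-\alpha S_u}r_\alpha(X_u)f(g_{u|1},\dots,g_{u|n})]$;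 $X_n=(g_n\cdots g_1)\cdot X_0$, $S_n=S_0-\log\|g_n\cdots g_1X_0\|$. For $y\in\mathbb R$, $\tau_y^-=\inf\{j\ge1:S_j+y<0\}$, $\tau_y^+=\inf\{j\ge1:S_j-y>0\}$. Dual walk. $\mathbb Q_x^{\alpha,*}$ is the law of a sequence $(h_i)_{i\ge1}$ of matrices together with $X_0^*=x$, $S_0^*=0$ such that $\mathbb E_{\mathbb Q_x^{\alpha,*}}f(h_1,\dots,h_n)=\frac1{r_\alpha^*(x)}\mathbb E[\sum_{|u|=n}r_\alpha^*((g_{u|n}^*\cdots g_{u|1}^* )\cdot x)\,\|g_{u|n}^*\cdots g_{u|1}^*x\|^\alpha f(g_{u|1}^*,\dots,g_{u|n}^* )]$; $S_n^*=-\log\|h_n\cdots h_1X_0^*\|$, $X_n^*=(h_n\cdots h_1)\cdot X_0^*$. Weak ladder epochs of $S^*$: $T_0^\pm=0$, $T_n^+=\inf\{j>T_{n-1}^+:S_j^*\ge S^*_{T_{n-1}^+}\}$, $T_n^-=\inf\{j>T_{n-1}^-:S_j^*\le S^*_{T_{n-1}^-}\}$. *)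

(* Defs.v *)
From HB Require Import structures.
From mathcomp Require Import all_boot all_order all_algebra.
From mathcomp Require Import all_classical all_reals all_analysis.

Set Implicit Arguments.
Unset Strict Implicit.
Unset Printing Implicit Defensive.

Import Order.TTheory GRing.Theory Num.Theory.
Import numFieldNormedType.Exports.

Local Open Scope classical_set_scope.
Local Open Scope ring_scope.

(* Extended natural numbers: [None] stands for infinity. *)
Definition enat := option nat.

Definition lt_enat (n : nat) (N : enat) : bool :=
  if N is Some k then (n < k)%N else true.

Definition enat_ereal (R : realType) (N : enat) : \bar R :=
  if N is Some k then (k%:R)%:E else +oo%E.

Definition enat_inf (A : set nat) : enat :=
  match pselect (exists j : nat, `[< A j >]) with
  | left h => Some (ex_minn h)
  | right _ => None
  end.

Section Matrices.
Variables (R : realType) (d : nat).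
Implicit Types (g : 'M[R]_d) (x v : 'cV[R]_d).

Definition vnorm v : R := \sum_(i < d) `|v i 0|.

Definition sphere : set 'cV[R]_d :=
  [set v : 'cV[R]_d | (forall i, 0 <= v i 0) /\ vnorm v = 1].

Definition nonneg_mx : set 'M[R]_d := [set g : 'M[R]_d | forall i j, 0 <= g i j].

Definition allowable : set 'M[R]_d :=
  [set g : 'M[R]_d | [/\ nonneg_mx g,
               forall i, exists j, 0 < g i j &
               forall j, exists i, 0 < g i j]].

Lemma allowable_mul g1 g2 :
  allowable g1 -> allowable g2 -> allowable (g1 *m g2).
Proof.
move=> [p1 r1 c1] [p2 r2 c2]; split => [i j|i|j].
- by rewrite mxE; apply: sumr_ge0 => k _; apply: mulr_ge0.
- have [k k0] := r1 i; have [j j0] := r2 k; exists j.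
  rewrite mxE (bigD1 k) //= ltr_wpDr ?mulr_gt0//.
  by apply: sumr_ge0 => l _; apply: mulr_ge0.
- have [k k0] := c2 j; have [i i0] := c1 k; exists i.
  rewrite mxE (bigD1 k) //= ltr_wpDr ?mulr_gt0//.
  by apply: sumr_ge0 => l _; apply: mulr_ge0.
Qed.

Definition opnorm g : R := sup [set vnorm (g *m x) | x in sphere].

Definition act g x : 'cV[R]_d := (vnorm (g *m x))^-1 *: (g *m x).

Definition sigma g x : R := ln (vnorm (g *m x)).

(* [mprod [:: g_1; ...; g_n]] is g_n * ... * g_1: the first matrix acts first. *)
Definition mprod (s : seq 'M[R]_d) : 'M[R]_d :=
  foldl (fun A g => g *m A) 1%:M s.

Definition borel_mx := g_sigma_algebraType (@open 'M[R]_d).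

(* Sequences of matrices, with the product (cylinder) sigma-algebra. *)
Definition mx_sequences := g_sigma_algebraType
  [set A : set (nat -> 'M[R]_d) | exists (j : nat) (B : set borel_mx),
     measurable B /\ A = [set w | B (w j)]].

Definition furstenberg_kesten (kappa : R) (Gamma : set 'M[R]_d) : Prop :=
  1 < kappa /\
  forall g, Gamma g ->
    (forall i j, 0 < g i j) /\ (forall i j k l, g i j <= kappa * g k l).

End Matrices.

(* Spectral radius of a linear operator T on the Banach space of continuous
   functions on the sphere.  A complex-valued function is the pair (u, v) of its
   real and imaginary parts and a + i b is the pair (a, b), so that
   (a + i b)(u + i v) - T(u + i v) has the two components written below.
   Functions are only considered up to equality on the sphere.  By the open
   mapping theorem, a + i b is in the resolvent set iff (a + i b) - T is
   bijective. *)
Section SpectralRadius.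
Variables (R : realType) (d : nat).
Implicit Types (T : ('cV[R]_d -> R) -> 'cV[R]_d -> R).

Definition cont_sphere (phi : 'cV[R]_d -> R) : Prop :=
  {within @sphere R d, continuous phi}.

Definition resolvent_eq T (a b : R) (u v f h : 'cV[R]_d -> R) : Prop :=
  forall x, sphere x ->
    a * u x - b * v x - T u x = f x /\ b * u x + a * v x - T v x = h x.

Definition resolvent_set T : set (R * R) := [set ab |
  (forall f h, cont_sphere f -> cont_sphere h ->
     exists u v, [/\ cont_sphere u, cont_sphere v &
                     resolvent_eq T ab.1 ab.2 u v f h]) /\
  (forall u v, cont_sphere u -> cont_sphere v ->
     resolvent_eq T ab.1 ab.2 u v (fun=> 0) (fun=> 0) ->
     forall x, sphere x -> u x = 0 /\ v x = 0)].

Definition spectral_radius T : R :=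
  sup [set Num.sqrt (ab.1 ^+ 2 + ab.2 ^+ 2) | ab in ~` resolvent_set T].

End SpectralRadius.

(* The Ulam-Harris tree is [seq nat]: the children of u are [rcons u j], with
   labels j starting from 0, the root is [::], and the ancestor u|k of u is
   [take k u].  [N u] is the number of children of u, possibly infinite, and
   [g u] is the matrix g_u carried by u; [g u w] is only meaningful if u is not
   the root and is alive in its parent's offspring. *)
Section Tree.
Variables (disp : measure_display) (Omega : measurableType disp).
Variables (R : realType) (d : nat) (P : probability Omega R).
Variables (N : seq nat -> Omega -> enat) (g : seq nat -> Omega -> 'M[R]_d).

(* The point process of u, as the sequence of its points; it is padded with the
   zero matrix, which is not allowable, so that it also encodes [N u]. *)
Definition offspring (u : seq nat) (w : Omega) : mx_sequences R d :=
  fun j : nat => if lt_enat j (N u w) then g (rcons u j) w else 0.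

Record matrix_brw : Prop := MatrixBRW {
  brw_allowable : forall u j w,
    lt_enat j (N u w) -> allowable (g (rcons u j) w) ;
  brw_measurable : forall u, measurable_fun setT (offspring u) ;
  brw_identically_distributed : forall u (A : set (mx_sequences R d)),
    measurable A -> P (offspring u @^-1` A) = P (offspring [::] @^-1` A) ;
  brw_independent :
    forall (s : seq (seq nat)) (A : seq nat -> set (mx_sequences R d)),
    uniq s -> (forall u, measurable (A u)) ->
    P [set w | forall u, u \in s -> A u (offspring u w)] =
    (\prod_(u <- s) P (offspring u @^-1` A u))%E }.

Definition alive (w : Omega) (u : seq nat) : Prop :=
  forall k, (k < size u)%N -> lt_enat (nth 0%N u k) (N (take k u) w).

Definition generation (n : nat) (w : Omega) : set (seq nat) :=
  [set u | size u = n /\ alive w u].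

(* Sum over the generation n of a real function of either sign, as the
   difference of the sums of its positive and negative parts. *)
Definition gen_sum (n : nat) (w : Omega) (F : seq nat -> R) : \bar R :=
  (\esum_(u in generation n w) (Num.max (F u) 0)%:E
   - \esum_(u in generation n w) (Num.max (- F u) 0)%:E)%E.

Definition lineage (n : nat) (u : seq nat) (w : Omega) : n.-tuple (borel_mx R d) :=
  [tuple (g (take k.+1 u) w : borel_mx R d) | k < n].

Definition lineage_tr (n : nat) (u : seq nat) (w : Omega) :
    n.-tuple (borel_mx R d) :=
  [tuple ((g (take k.+1 u) w)^T : borel_mx R d) | k < n].

Definition tree_prod (u : seq nat) (w : Omega) : 'M[R]_d :=
  mprod [seq g (take k.+1 u) w | k <- iota 0 (size u)].

Definition tree_dir (x : 'cV[R]_d) (u : seq nat) (w : Omega) : 'cV[R]_d := act (tree_prod u w) x.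

Definition tree_pos (x : 'cV[R]_d) (u : seq nat) (w : Omega) : R :=
  - ln (vnorm (tree_prod u w *m x)).

Definition moment_domain : set R := [set s : R | 0 <= s /\
  (\int[P]_w gen_sum 1 w (fun u => (opnorm (tree_prod u w) `^ s)%R) < +oo)%E].

Definition transfer (s : R) (phi : 'cV[R]_d -> R) (x : 'cV[R]_d) : R :=
  fine (\int[P]_w gen_sum 1 w (fun u =>
    (expR (s * sigma (tree_prod u w) x) * phi (act (tree_prod u w) x))%R)).

Definition transfer_dual (s : R) (phi : 'cV[R]_d -> R) (x : 'cV[R]_d) : R :=
  fine (\int[P]_w gen_sum 1 w (fun u =>
    (expR (s * sigma ((tree_prod u w)^T) x) * phi (act ((tree_prod u w)^T) x))%R)).

Definition m_radius (s : R) : R := spectral_radius (transfer s).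

Definition positive_eigenfunction (T : ('cV[R]_d -> R) -> 'cV[R]_d -> R)
    (lambda : R) (r : 'cV[R]_d -> R) : Prop :=
  [/\ cont_sphere r, (forall x, sphere x -> 0 < r x) &
      forall x, sphere x -> T r x = lambda * r x].

Definition subsemigroup_in (A H : set 'M[R]_d) : Prop :=
  [/\ H `<=` A, (forall g1 g2, H g1 -> H g2 -> H (g1 *m g2)) &
      closure H `&` A `<=` H].

Definition carries_first_generation (H : set 'M[R]_d) : Prop :=
  {ae P, forall w, forall u, generation 1 w u -> H (tree_prod u w)}.

(* Gamma is the smallest subsemigroup of A, closed in A, that contains the first
   generation with probability 1.  The semigroup of the model is taken with
   A = allowable matrices: products such as g^n may converge to the zero matrix,
   which a semigroup closed among all nonnegative matrices would then contain,
   against the Furstenberg-Kesten condition.  By the lemma below this choice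
   gives the smaller semigroup, so that conditions bearing on all elements of
   Gamma are weaker than with A = nonnegative matrices. *)
Definition smallest_semigroup (A Gamma : set 'M[R]_d) : Prop :=
  [/\ subsemigroup_in A Gamma, carries_first_generation Gamma &
      forall H, subsemigroup_in A H -> carries_first_generation H ->
        Gamma `<=` H].

Definition boundary_case (alpha : R) : Prop :=
  ({ae P, forall w, N [::] w = Some 1%N} \/
   (1%:E < \int[P]_w enat_ereal R (N [::] w))%E) /\
  [/\ (interior moment_domain) alpha, m_radius alpha = 1 &
      is_derive alpha 1 m_radius 0].

Lemma smallest_semigroup_allowable (Gamma Gamma' : set 'M[R]_d) :
  matrix_brw ->
  smallest_semigroup (@allowable R d) Gamma ->
  smallest_semigroup (@nonneg_mx R d) Gamma' ->
  Gamma `<=` Gamma'.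
Proof.
move=> brw [_ _ Gmin] [[Gnn Gmul Gcl] Gae _].
suff : Gamma `<=` Gamma' `&` @allowable R d by move=> sub k /sub[].
apply: Gmin.
  split => [k []//|g1 g2 [G1 A1] [G2 A2]|k [clk Ak]].
    split; first exact: Gmul.
    exact: allowable_mul.
  split=> //; apply: Gcl; split; last by case: Ak.
  by apply: closureS clk => ? [].
move: Gae; rewrite /carries_first_generation; apply: filterS => w Gw u gu.
split; first exact: Gw.
case: gu => su /(_ 0%N); case: u su => [//|j [|//]] _ /(_ isT) /= lt.
suff -> : tree_prod [:: j] w = g [:: j] w by exact: (brw_allowable brw (u := [::])).
by rewrite /tree_prod /mprod /= mulmx1.
Qed.

Section ChangedMeasure.
Variables (disp' : measure_display) (Omega' : measurableType disp').
Variables (Q : probability Omega' R) (h : nat -> Omega' -> 'M[R]_d).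
Variables (alpha : R) (r : 'cV[R]_d -> R) (x : 'cV[R]_d).

(* The sequences below are indexed from 0: [h i] is the (i+1)-st matrix. *)
Definition prefix_tuple (n : nat) (w : Omega') : n.-tuple (borel_mx R d) :=
  [tuple (h i w : borel_mx R d) | i < n].

(* Under Q, (h i)_i has the law Q_x^alpha associated with r = r_alpha. *)
Definition original_law : Prop :=
  (forall i, measurable_fun setT (h i : Omega' -> borel_mx R d)) /\
  forall (n : nat) (f : n.-tuple (borel_mx R d) -> R), (0 < n)%N ->
    measurable_fun setT f -> (exists M, forall z, `|f z| <= M) ->
    (\int[Q]_w (f (prefix_tuple n w))%:E =
    ((r x)^-1)%R%:E * \int[P]_w gen_sum n w (fun u =>
       (expR (- alpha * tree_pos x u w) * r (tree_dir x u w) * f (lineage n u w))%R))%E.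

(* Under Q, (h i)_i has the law Q_x^(alpha,* ) associated with r = r_alpha^*. *)
Definition dual_law : Prop :=
  (forall i, measurable_fun setT (h i : Omega' -> borel_mx R d)) /\
  forall (n : nat) (f : n.-tuple (borel_mx R d) -> R), (0 < n)%N ->
    measurable_fun setT f -> (exists M, forall z, `|f z| <= M) ->
    (\int[Q]_w (f (prefix_tuple n w))%:E =
    ((r x)^-1)%R%:E * \int[P]_w gen_sum n w (fun u =>
       (r (act (mprod (lineage_tr n u w)) x)
       * vnorm (mprod (lineage_tr n u w) *m x) `^ alpha
       * f (lineage_tr n u w))%R))%E.

End ChangedMeasure.

End Tree.

Section Walk.
Variables (Omega : Type) (R : realType) (d : nat).
Variables (h : nat -> Omega -> 'M[R]_d) (x : 'cV[R]_d).

(* S_n = - log |h_n ... h_1 x|; S_0 = 0 when x is on the sphere. *)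
Definition walk (n : nat) (w : Omega) : R :=
  - ln (vnorm (mprod [seq h i w | i <- iota 0 n] *m x)).

End Walk.

Section Paths.
Variables (R : realType).
Implicit Types (s : nat -> R) (A : set R).

Definition tau_minus (y : R) s : enat :=
  enat_inf [set j | (1 <= j)%N /\ s j + y < 0].

Definition tau_plus (y : R) s : enat :=
  enat_inf [set j | (1 <= j)%N /\ s j - y > 0].

Fixpoint ladder_plus s (n : nat) : enat :=
  if n is n'.+1 then
    if ladder_plus s n' is Some k then
      enat_inf [set j | (k < j)%N /\ s j >= s k]
    else None
  else Some 0%N.

Fixpoint ladder_minus s (n : nat) : enat :=
  if n is n'.+1 then
    if ladder_minus s n' is Some k then
      enat_inf [set j | (k < j)%N /\ s j <= s k]
    else None
  else Some 0%N.

Definition visits_before (tau : enat) A s : \bar R :=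
  \esum_(n in [set n | lt_enat n tau]) (\1_A (s n))%:E.

(* Infinite epochs contribute nothing. *)
Definition ladder_visits (T : nat -> enat) A s : \bar R :=
  \esum_(j in [set: nat]) (if T j is Some k then \1_A (s k) else 0)%:E.

End Paths.

(* Main.v *)
Require Import Defs.
From HB Require Import structures.
From mathcomp Require Import all_boot all_order all_algebra.
From mathcomp Require Import all_classical all_reals all_analysis.
From mathcomp Require Import measurable_realfun.
From mathcomp Require Import ring lra.

Set Implicit Arguments.
Unset Strict Implicit.
Unset Printing Implicit Defensive.

Import Order.TTheory GRing.Theory Num.Theory.
Import numFieldNormedType.Exports.

Local Open Scope classical_set_scope.
Local Open Scope ring_scope.

(** Let mu be the intensity of the point process of matrices. Summing over the
    generation n of the tree gives the lineages (g_1, ..., g_n) the intensity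
    mu^n, which is invariant under reversal of the order. Up to the factors
    r (X_n) / r x, which are bounded above and below because the sphere is compact,
    the original walk has density |g_n ... g_1 x|^alpha with respect to mu^n, and
    the dual walk has density |h_n ... h_1 y|^alpha with respect to the image of
    mu^n under transposition. If (h_1, ..., h_n) is the reversed sequence of the
    transposes of (g_1, ..., g_n), then h_n ... h_1 is the transpose of
    G = g_n ... g_1. All the entries of G are comparable up to the factor kappa,
    so ln |G x| and ln |G^T y| differ by at most ln kappa <= c1, and both densities
    are comparable after reversal ([biased_law_le]).

    On such a pair of sequences the increment of the dual walk between the times i
    and n is -ln |g_1^T ... g_(n-i)^T y'| for some y' in the sphere, hence is within
    c1 of the position of the original walk at the time n - i. So if n is a weak
    ascending record of the dual walk, then the original walk stays above -c1 up to
    the time n ([record_stay]); conversely, if the original walk stays above c1,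
    then n is a record of the dual walk ([stay_record]). The weak ladder epochs are
    exactly the record times ([ladder_visits_records]), and summation over n turns
    these inclusions and the comparison of the densities into the inequalities. The
    descending case is the same statement for the walks multiplied by -1.

    The invariance under reversal ([branch_reversal]) is proved node by node: for a
    node u with labels u_1, ..., u_n the matrices along the lineage come from the
    offspring of n distinct nodes, so they are independent and the law of the k-th
    one depends on the label u_k only; reversing the word u therefore reverses the
    lineage in law, and reversal permutes the words of length n. *)

(** * Products of nonnegative matrices *)

Section MatrixProducts.
Variables (R : realType) (d : nat).
Implicit Types (g A B : 'M[R]_d) (x y v : 'cV[R]_d) (s t : seq 'M[R]_d).

Lemma mprod_cat s t : mprod (s ++ t) = mprod t *m mprod s.
Proof.
rewrite /mprod foldl_cat; move: (foldl _ _ s) => A.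
elim: t A => [|g t IH] A /=; first by rewrite mul1mx.
by rewrite IH (IH (g *m 1%:M)) mulmx1 mulmxA.
Qed.

Lemma mprod1 g : mprod [:: g] = g.
Proof. by rewrite /mprod /= mulmx1. Qed.

Lemma mprod_rcons s g : mprod (rcons s g) = g *m mprod s.
Proof. by rewrite -cats1 mprod_cat mprod1. Qed.

(** The dual walk driven by this sequence ends with the transpose of the product
    of [s]. *)
Definition dual_seq s := rev (map trmx s).

Lemma mprod_dual_seq s : mprod (dual_seq s) = (mprod s)^T.
Proof.
elim: s => [|g s IH]; first by rewrite /mprod /= trmx1.
rewrite /dual_seq /= rev_cons mprod_rcons IH -trmx_mul; congr (_^T).
by rewrite -cat1s mprod_cat mprod1.
Qed.

Lemma size_dual_seq s : size (dual_seq s) = size s.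
Proof. by rewrite size_rev size_map. Qed.

Lemma drop_dual_seq n s : drop n (dual_seq s) = dual_seq (take (size s - n) s).
Proof. by rewrite /dual_seq drop_rev size_map map_take. Qed.

Lemma vnorm_ge0 v : 0 <= vnorm v.
Proof. exact: sumr_ge0. Qed.

Lemma vnormZ (a : R) v : vnorm (a *: v) = `|a| * vnorm v.
Proof. by rewrite /vnorm mulr_sumr; apply: eq_bigr => i _; rewrite mxE normrM. Qed.

Lemma sphere_sum x : sphere x -> \sum_i x i 0 = 1.
Proof.
by move=> [x0 <-]; apply: eq_bigr => i _; rewrite ger0_norm.
Qed.

Lemma vnorm_nonneg_mx A x : nonneg_mx A -> sphere x ->
  vnorm (A *m x) = \sum_i \sum_j A i j * x j 0.
Proof.
move=> A0 [x0 _]; apply: eq_bigr => i _; rewrite mxE ger0_norm//.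
by apply: sumr_ge0 => j _; apply: mulr_ge0.
Qed.

(** A vector of the sphere averages the rows of a matrix, so entrywise
    comparability is inherited by the norms of the images. *)
Lemma ler_vnorm_comparable (k : R) A B x y : nonneg_mx A -> nonneg_mx B ->
  (forall i j l m, A i j <= k * B l m) -> sphere x -> sphere y ->
  vnorm (A *m x) <= k * vnorm (B *m y).
Proof.
move=> A0 B0 AB sx sy; rewrite !vnorm_nonneg_mx// mulr_sumr.
apply: ler_sum => i _.
have x0 := sx.1; have y0 := sy.1.
have {1}-> : \sum_j A i j * x j 0 = \sum_j \sum_l A i j * (x j 0 * y l 0).
  apply: eq_bigr => j _; rewrite -mulr_sumr -mulr_sumr.
  by rewrite (sphere_sum sy) mulr1.
have -> : k * (\sum_l B i l * y l 0) = \sum_j \sum_l k * B i l * (x j 0 * y l 0).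
  rewrite exchange_big mulr_sumr/=; apply: eq_bigr => l _.
  by rewrite -mulr_sumr -mulr_suml (sphere_sum sx) mul1r mulrA.
apply: ler_sum => j _; apply: ler_sum => l _; apply: ler_wpM2r => //.
exact: mulr_ge0.
Qed.

Lemma allowable1 : allowable (1%:M : 'M[R]_d).
Proof.
split => [i j|i|j]; first by rewrite mxE ler0n.
- by exists i; rewrite mxE eqxx.
- by exists j; rewrite mxE eqxx.
Qed.

Lemma allowable_tr A : allowable A -> allowable A^T.
Proof.
move=> [A0 Ar Ac]; split=> [i j|i|j]; first by rewrite mxE.
- by have [j] := Ac i; exists j; rewrite mxE.
- by have [i] := Ar j; exists i; rewrite mxE.
Qed.

Lemma allowable_mprod s : (forall g, g \in s -> allowable g) -> allowable (mprod s).
Proof.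
elim/last_ind: s => [_|s g IH sg]; first exact: allowable1.
rewrite mprod_rcons; apply: allowable_mul.
  by apply: sg; rewrite mem_rcons mem_head.
by apply: IH => k ks; apply: sg; rewrite mem_rcons inE ks orbT.
Qed.

Lemma allowable_vnorm_gt0 A x : allowable A -> sphere x -> 0 < vnorm (A *m x).
Proof.
move=> [A0 _ Ac] sx; rewrite vnorm_nonneg_mx// exchange_big/=.
have x0 := sx.1.
have [j xj] : exists j, 0 < x j 0.
  apply: contrapT => /forallNP nx; have := sphere_sum sx.
  rewrite big1 => [/eqP|i _]; first by rewrite eq_sym oner_eq0.
  by apply/eqP; rewrite eq_le x0 leNgt andbT; apply/negP/nx.
have [i Aij] := Ac j.
rewrite (bigD1 j)//= ltr_wpDr//; last first.
  by rewrite (bigD1 i)//= ltr_wpDr ?mulr_gt0//; apply: sumr_ge0 => l _;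
     apply: mulr_ge0.
by apply: sumr_ge0 => l _; apply: sumr_ge0 => m _; apply: mulr_ge0.
Qed.

Lemma sphere_act A x : allowable A -> sphere x -> sphere (act A x).
Proof.
move=> aA sx; have n0 := allowable_vnorm_gt0 aA sx; split=> [i|].
  rewrite !mxE mulr_ge0 ?invr_ge0 ?vnorm_ge0//.
  by apply: sumr_ge0 => j _; rewrite mulr_ge0//; [case: aA|exact: sx.1].
by rewrite vnormZ ger0_norm ?invr_ge0 ?vnorm_ge0// mulVf// gt_eqF.
Qed.

(** The factor [e] is meant to be 1 or -1: the statements on ascending and on
    descending ladder epochs are then instances of a single one. *)
Definition position (e : R) x s : R := e * - ln (vnorm (mprod s *m x)).

(** The cocycle property of the logarithm of the norm. *)
Lemma position_cat e x s t :
  (forall g, g \in s -> allowable g) -> (forall g, g \in t -> allowable g) ->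
  sphere x ->
  position e x (s ++ t) = position e x s + position e (act (mprod s) x) t.
Proof.
move=> /allowable_mprod As /allowable_mprod At sx.
have n0 := allowable_vnorm_gt0 As sx.
have m0 := allowable_vnorm_gt0 At (sphere_act As sx).
rewrite /position -mulrDr -opprD -lnM ?posrE//; do 3 congr (_ _).
rewrite -{1}[vnorm (mprod s *m x)]ger0_norm ?vnorm_ge0// -vnormZ /act.
by rewrite -scalemxAr scalerA divff ?gt_eqF// scale1r mprod_cat mulmxA.
Qed.

End MatrixProducts.

Section Distortion.
Variables (R : realType) (d : nat) (kappa : R) (Gamma : set 'M[R]_d).
Hypotheses (FK : furstenberg_kesten kappa Gamma)
  (Gamma_mul : forall g1 g2, Gamma g1 -> Gamma g2 -> Gamma (g1 *m g2))
  (Gamma_allowable : Gamma `<=` @allowable R d).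
Implicit Types (x y : 'cV[R]_d) (s : seq 'M[R]_d).

Lemma Gamma_mprod s : s != [::] -> (forall g, g \in s -> Gamma g) -> Gamma (mprod s).
Proof.
elim/last_ind: s => [//|s g IH] _ sG; rewrite mprod_rcons.
have Gg : Gamma g by apply: sG; rewrite mem_rcons mem_head.
have [->|s0] := eqVneq s [::]; first by rewrite /mprod /= mulmx1.
apply: Gamma_mul => //; apply: IH => // k ks.
by apply: sG; rewrite mem_rcons inE ks orbT.
Qed.

(** A nonempty product of elements of [Gamma] is in [Gamma], so its entries are comparable
    up to the factor [kappa] whatever the number of factors; its transpose has the
    same entries. *)
Lemma dual_norm_distortion s x y : (forall g, g \in s -> Gamma g) ->
  sphere x -> sphere y ->
  `|ln (vnorm (mprod s *m x)) - ln (vnorm (mprod (dual_seq s) *m y))| <= ln kappa.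
Proof.
move=> sG sx sy; have [k1 FKG] := FK.
have k0 : 0 < kappa by exact: lt_trans k1.
have aG : allowable (mprod s) by apply: allowable_mprod => g /sG /Gamma_allowable.
rewrite mprod_dual_seq.
have [s0|/Gamma_mprod/(_ sG)/FKG [_ cmp]] := eqVneq s [::].
  rewrite s0 /mprod /= trmx1 !mul1mx (proj2 sx) (proj2 sy) subrr normr0.
  by rewrite ln_ge0// ltW.
have gx0 := allowable_vnorm_gt0 aG sx.
have gy0 := allowable_vnorm_gt0 (allowable_tr aG) sy.
have [nn _ _] := aG; have [nnT _ _] := allowable_tr aG.
have le1 : vnorm (mprod s *m x) <= kappa * vnorm ((mprod s)^T *m y).
  by apply: ler_vnorm_comparable => // i j l m; rewrite mxE.
have le2 : vnorm ((mprod s)^T *m y) <= kappa * vnorm (mprod s *m x).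
  by apply: ler_vnorm_comparable => // i j l m; rewrite mxE.
have ln_le a b : 0 < a -> 0 < b -> a <= kappa * b -> ln a - ln b <= ln kappa.
  by move=> a0 b0 ab; rewrite lerBlDr -lnM ?posrE// ler_ln ?posrE ?mulr_gt0.
by rewrite ler_norml lerNl opprB !ln_le.
Qed.

End Distortion.

(** * Bounds for positive continuous functions on the sphere *)

Section SphereCompact.
Variables (R : realType).

Lemma trmx_continuous m n : continuous (fun A : 'M[R]_(m, n) => A^T).
Proof.
move=> A B [P AP PB]; exists (fun i j => P j i).
  by move=> i j; have := AP j i; rewrite mxE.
by move=> M MP; apply: PB => i j; rewrite mxE; exact: MP.
Qed.

Variable d : nat.

Lemma vnorm_continuous : continuous (@vnorm R d).
Proof.
apply: (continuous_big add_continuous) => i _ v.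
apply: continuous_comp; first exact: coord_continuous.
exact: norm_continuous.
Qed.

Lemma sphere_compact : compact (@sphere R d).
Proof.
pose box : set 'cV[R]_d :=
  trmx @` [set v : 'rV[R]_d | forall i, `[0, 1]%classic (v ord0 i)].
have box_compact : compact box.
  apply: continuous_compact.
    by apply: continuous_subspaceT; exact: trmx_continuous.
  apply: (@rV_compact R d (fun=> `[0, 1]%classic)) => _; exact: segment_compact.
apply: subclosed_compact box_compact _; last first.
  move=> v sv; exists v^T; last by rewrite trmxK.
  move=> i; rewrite /= mxE in_itv/= sv.1/= -(sphere_sum sv) (bigD1 i)//=.
  by rewrite lerDl; apply: sumr_ge0 => j _; exact: sv.1.
have -> : @sphere R d =
    \bigcap_(i in [set: 'I_d]) ((fun v : 'cV[R]_d => v i 0) @^-1` [set a | 0 <= a])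
    `&` (@vnorm R d) @^-1` [set 1].
  by apply/seteqP; split=> v [v0 v1]; split=> // i; [move=> _|]; exact: v0.
apply: closedI.
  apply: closed_bigI => i _; apply: preimage_closed; last exact: closed_ge.
  by move=> v _; exact: coord_continuous.
apply: preimage_closed; last exact: closed_eq.
by move=> v _; exact: vnorm_continuous.
Qed.

Lemma sphere_bounds (r : 'cV[R]_d -> R) :
  cont_sphere r -> (forall x, sphere x -> 0 < r x) ->
  exists m M, [/\ 0 < m, 0 < M & forall x, sphere x -> m <= r x <= M].
Proof.
move=> cr r0; have [x0|/forallNP nx] := pselect (@sphere R d !=set0); last first.
  by exists 1, 1; split=> // x /nx.
have [a /set_mem sa ra] := compact_EVT_min x0 sphere_compact cr.
have [b /set_mem sb rb] := compact_EVT_max x0 sphere_compact cr.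
exists (r a), (r b); split; [exact: r0|exact: r0|move=> x /mem_set sx].
by rewrite ra// rb.
Qed.

End SphereCompact.

(** * Measurability *)

Section Measurability.
Variables (R : realType) (d : nat).
Local Notation mx := (borel_mx R d).

Lemma measurable_entry i j : measurable_fun setT (fun A : mx => (A : 'M[R]_d) i j).
Proof.
apply: (measurability _ (RGenOpens.measurableE R)) => _ [_ [a [b ->] <-]].
rewrite setTI; apply: sub_sigma_algebra.
have /continuousP := @coord_continuous R d d i j; apply; exact: interval_open.
Qed.

Lemma measurable_trmx : measurable_fun setT (fun A : mx => (A : 'M[R]_d)^T : mx).
Proof.
apply: (@measurability _ _ mx mx setT _ (@open 'M[R]_d)) => [|_ [U oU <-]]; first by [].

rewrite setTI; apply: sub_sigma_algebra.
by have /continuousP := @trmx_continuous R d d; apply.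
Qed.

Lemma measurable_closed_mx (F : set 'M[R]_d) : closed F -> measurable (F : set mx).
Proof.
move=> cF; rewrite -[F]setCK; apply: measurableC.
by apply: sub_sigma_algebra; exact: closed_openC.
Qed.

Lemma measurable_zero_mx : measurable ([set (0 : 'M[R]_d)] : set mx).
Proof.
have -> : ([set 0] : set mx) = \bigcap_(i in [set: 'I_d]) \bigcap_(j in [set: 'I_d])
    (fun A : mx => (A : 'M[R]_d) i j) @^-1` [set 0].
  apply/seteqP; split => [A -> i _ j _/=|A A0]; first by rewrite mxE.
  by apply/matrixP => i j; rewrite mxE; exact: A0.
apply: fin_bigcap_measurable => // i _; apply: fin_bigcap_measurable => // j _.
by rewrite -[_ @^-1` _]setTI; apply: measurable_entry.
Qed.

Lemma measurable_nth n k (i j : 'I_d) : (k < n)%N ->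
  measurable_fun setT (fun z : n.-tuple mx => (nth 0 z k : 'M[R]_d) i j).
Proof.
move=> kn; apply: (eq_measurable_fun (fun z : n.-tuple mx =>
    (tnth z (Ordinal kn) : 'M[R]_d) i j)).
  by move=> z _; rewrite (tnth_nth 0).
apply: (measurableT_comp (measurable_entry i j)); exact: measurable_tnth.
Qed.

Lemma measurable_vnorm_take n k (x : 'cV[R]_d) : (k <= n)%N ->
  measurable_fun setT (fun z : n.-tuple mx =>
    vnorm (mprod (take k (z : seq 'M[R]_d)) *m x)).
Proof.
move=> kn; have mP : forall i, measurable_fun setT (fun z : n.-tuple mx =>
    (mprod (take k (z : seq 'M[R]_d)) *m x) i 0).
  elim: k kn => [|k IH] kn i.
    apply: (eq_measurable_fun (fun=> x i 0)) => // z _.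
    by rewrite take0 /mprod /= mul1mx.
  apply: (eq_measurable_fun (fun z : n.-tuple mx => \sum_j
     (nth 0 z k : 'M[R]_d) i j * (mprod (take k (z : seq 'M[R]_d)) *m x) j 0)).
    move=> z _; rewrite (take_nth 0) ?size_tuple// mprod_rcons -mulmxA.
    by rewrite [in RHS]mxE.
  apply: measurable_sum => j; apply: measurable_funM; first exact: measurable_nth.
  exact: (IH (ltnW kn) j).
by apply: measurable_sum => i; apply: measurableT_comp => //; exact: normr_measurable.
Qed.

Lemma measurable_position_take n k e (x : 'cV[R]_d) : (k <= n)%N ->
  measurable_fun setT (fun z : n.-tuple mx =>
    position e x (take k (z : seq 'M[R]_d))).
Proof.
move=> kn; apply: measurable_funM; first exact: measurable_cst.
apply: measurableT_comp; first exact: oppr_measurable.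
apply: measurableT_comp; first exact: measurable_ln.
exact: measurable_vnorm_take.
Qed.

End Measurability.

(** * The intensity of the lineages and its invariance under reversal *)

(** The boxes are stable under intersection and generate the product
    sigma-algebra. *)
Lemma tuple_measure_unique d (R : realType) (T : measurableType d) n
    (m1 m2 : {measure set (n.-tuple T) -> \bar R}) :
  (m1 setT < +oo)%E ->
  (forall B : 'I_n -> set T, (forall i, measurable (B i)) ->
    m1 [set z | forall i, B i (tnth z i)] = m2 [set z | forall i, B i (tnth z i)]) ->
  forall A, measurable A -> m1 A = m2 A.
Proof.
move=> m1fin m12.
pose box (B : 'I_n -> set T) : set (n.-tuple T) := [set z | forall i, B i (tnth z i)].
pose G : set (set (n.-tuple T)) :=
  [set X | exists2 B : 'I_n -> set T, (forall i, measurable (B i)) & X = box B].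
have boxT : box (fun=> setT) = setT by apply/seteqP; split.
have mbox B : (forall i, measurable (B i)) -> measurable (box B).
  move=> mB; have -> : box B = \bigcap_(i in [set: 'I_n]) ((@tnth _ T ^~ i) @^-1` B i).
    by apply/seteqP; split=> z zB i; [move=> _|]; apply: zB.
  apply: fin_bigcap_measurable => // i _; rewrite -[_ @^-1` _]setTI.
  exact: measurable_tnth.
have mG A : measurable A -> <<s G >> A.
  apply: smallest_sub; first exact: smallest_sigma_algebra.
  move=> X; rewrite -bigcup_seq => -[i _ [Y mY <-]]; apply: sub_sigma_algebra.
  exists (fun j => if j == i then Y else setT) => [j|]; first by case: ifP.
  rewrite setTI; apply/seteqP; split => [z zY j|z /(_ i)]; last by rewrite eqxx.
  by case: eqP => // ->.
move=> A /mG; apply: (g_sigma_algebra_measure_unique G _ (fun=> setT)) => //.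
- by move=> _ [B mB ->]; exact: mbox.
- by move=> _; exists (fun=> setT).
- by apply/seteqP; split=> // z _; exists 0%N.
- move=> _ _ [B1 m1B ->] [B2 m2B ->]; exists (fun i => B1 i `&` B2 i).
    by move=> i; exact: measurableI.
  apply/seteqP; split=> [z [z1 z2] i|z z12]; first by split; [exact: z1|exact: z2].
  by split=> i; have [] := z12 i.
- by move=> _ [B mB ->]; exact: m12.
Qed.

(** Monotone convergence, along an enumeration of [U]. *)
Lemma integral_esum_countable d (T : measurableType d) (R : realType)
    (mu : {measure set T -> \bar R}) (U : countType) (D : set U) (f : U -> T -> \bar R) :
  (forall u, measurable_fun setT (f u)) -> (forall u w, (0 <= f u w)%E) ->
  (\int[mu]_w (\esum_(u in D) f u w) = \esum_(u in D) (\int[mu]_w f u w))%E.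
Proof.
move=> mf f0.
pose term (a : U -> \bar R) k :=
  if @pickle_inv U k is Some u then if u \in D then a u else 0%E else 0%E.
have esum_nat (a : U -> \bar R) : (forall u, 0 <= a u)%E ->
    (\esum_(u in D) a u = \sum_(k <oo) term a k)%E.
  move=> a0; have b0 k : (0 <= term a k)%E.
    by rewrite /term; case: (@pickle_inv U k) => // u; case: ifP.
  rewrite nneseries_esumT//.
  rewrite [RHS](_ : _ = \esum_(k in pickle @` D) term a k); last first.
    rewrite [RHS]esum_mkcond; apply: eq_esum => k _.
    case: ifPn => // /negP nk; rewrite /term; case E: (@pickle_inv U k) => [u|//].
    case: ifPn => // uD; exfalso; apply: nk; rewrite inE; exists u; first exact/set_mem.
    by have := @pickle_invK U k; rewrite E.
  rewrite esum_image; last by move=> u v _ _; exact: (pcan_inj pickleK_inv).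
  by apply: eq_esum => u uD; rewrite /term pickleK_inv mem_set.
rewrite esum_nat; last by move=> u; exact: integral_ge0.
under eq_integral do rewrite esum_nat//.
rewrite integral_nneseries//; first last.
- by move=> k w _; rewrite /term; case: (@pickle_inv U k) => // u; case: ifP.
- move=> k; rewrite /term; case: (@pickle_inv U k) => [u|]; last exact: measurable_cst.
  by case: (u \in D); [|exact: measurable_cst].
apply: eq_eseriesr => k _; rewrite /term; case: (@pickle_inv U k) => [u|]; last first.
  exact: integral0.
by case: (u \in D); [|exact: integral0].
Qed.

(** The Lebesgue integral of a nonnegative function is the supremum of the
    integrals of the simple functions below it, hence it is monotone on all
    functions. The eigenfunctions, whose continuity is only assumed on the sphere,
    can thus be replaced by their bounds under the integral. *)
Lemma ge0_le_lower_integral d (T : measurableType d) (R : realType)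
    (mu : {measure set T -> \bar R}) (f1 f2 : T -> \bar R) :
  (forall w, 0 <= f1 w)%E -> (forall w, f1 w <= f2 w)%E ->
  (\int[mu]_w f1 w <= \int[mu]_w f2 w)%E.
Proof.
move=> f10 f12; rewrite !ge0_integralTE//; last first.
  by move=> w; exact: le_trans (f12 w).
by apply: ereal_sup_le => _ [h hf <-]; exists h => // w; exact: le_trans (f12 w).
Qed.

Section Branches.
Variables (R : realType) (d : nat).
Hypothesis d_gt0 : (0 < d)%N.
Variables (disp : measure_display) (Omega : measurableType disp).
Variables (P : probability Omega R).
Variables (N : seq nat -> Omega -> enat) (g : seq nat -> Omega -> 'M[R]_d).
Hypothesis brw : matrix_brw P N g.
Local Notation mx := (borel_mx R d).
Implicit Types (u v : seq nat) (w : Omega).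

(** The lineage of [u] read off the offspring sequences, in which an ancestor that
    is not alive contributes the zero matrix: unlike [lineage], it is a measurable
    function on the whole space. *)
Definition branch n u w : n.-tuple mx :=
  [tuple (offspring N g (take k u) w (nth 0%N u k) : mx) | k < n].

Lemma tnth_branch n u w k :
  tnth (branch n u w) k = offspring N g (take k u) w (nth 0%N u k).
Proof. by rewrite tnth_mktuple. Qed.

Lemma measurable_coord (j : nat) (B : set mx) : measurable B ->
  measurable ([set o : mx_sequences R d | B (o j)]).
Proof. by move=> mB; apply: sub_sigma_algebra; exists j, B. Qed.

Lemma measurable_offspring v (j : nat) :
  measurable_fun setT (fun w => offspring N g v w j : mx).
Proof.
move=> _ B mB; rewrite setTI.
by have := brw_measurable brw v measurableT (measurable_coord j mB); rewrite setTI.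
Qed.

Lemma measurable_branch n u : measurable_fun setT (branch n u).
Proof.
apply/measurable_fun_tnthP => k.
apply: (eq_measurable_fun (fun w => offspring N g (take k u) w (nth 0%N u k) : mx)).
  by move=> w _; rewrite /= tnth_branch.
exact: measurable_offspring.
Qed.

(** The entries of a branch come from the offspring of distinct nodes, so they
    are independent. *)
Lemma branch_box n u (B : 'I_n -> set mx) : size u = n ->
  (forall k, measurable (B k)) ->
  P [set w | forall k, B k (tnth (branch n u w) k)] =
  (\prod_(k < n) P [set w | B k (offspring N g [::] w (nth 0%N u k))])%E.
Proof.
move=> un mB.
(* The node at depth k of the lineage is recognized by its size, so that the event
   imposed on a node can be defined for all words. *)
pose B' k := if insub k is Some i then B i else setT.
have B'E (k : 'I_n) : B' k = B k by rewrite /B' valK.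
pose A v := [set o : mx_sequences R d | B' (size v) (o (nth 0%N u (size v)))].
have mA v : measurable (A v).
  by apply: measurable_coord; rewrite /B'; case: insub => [i|].
pose s := [seq take k u | k <- iota 0 n].
have sz k : (k < n)%N -> size (take k u) = k by move=> kn; rewrite size_takel// un ltnW.
have us : uniq s.
  rewrite map_inj_in_uniq ?iota_uniq// => i j; rewrite !mem_iota !add0n => ii jj.
  by move/(congr1 size); rewrite !sz.
have -> : [set w | forall k, B k (tnth (branch n u w) k)] =
          [set w | forall v, v \in s -> A v (offspring N g v w)].
  apply/seteqP; split=> [w wB v /mapP[k]|w wA k].
    rewrite mem_iota add0n /= => kn ->; rewrite /A /= sz//.
    by have := wB (Ordinal kn); rewrite tnth_branch -B'E.
  have /wA : take k u \in s by apply/mapP; exists (nat_of_ord k); rewrite ?mem_iota /=.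
  by rewrite /A /= sz// B'E tnth_branch.
rewrite (brw_independent brw us mA) big_map -[n in iota 0 n]subn0 big_mkord.
apply: eq_bigr => k _; rewrite (brw_identically_distributed brw _ (mA _)).
by congr (P _); apply/seteqP; split=> w; rewrite /A /= sz// B'E.
Qed.

Definition rev_tuple_mx n (z : n.-tuple mx) : n.-tuple mx := [tuple of rev z].

Lemma tnth_rev_tuple n (z : n.-tuple mx) k : tnth (rev_tuple_mx z) k = tnth z (rev_ord k).
Proof.
rewrite !(tnth_nth (0 : 'M[R]_d)) /= nth_rev size_tuple//.
Qed.

Lemma measurable_rev_tuple n : measurable_fun setT (@rev_tuple_mx n).
Proof.
apply/measurable_fun_tnthP => k.
apply: (eq_measurable_fun (fun z : n.-tuple mx => tnth z (rev_ord k))).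
  by move=> z _; rewrite /= tnth_rev_tuple.
exact: measurable_tnth.
Qed.

(** The law of a branch is a product whose factors depend on the labels only,
    so that reversing the labels reverses the branch in law. *)
Lemma branch_reversal n u (W : n.-tuple mx -> \bar R) : size u = n ->
  measurable_fun setT W -> (forall z, 0 <= W z)%E ->
  (\int[P]_w W (rev_tuple_mx (branch n u w)) = \int[P]_w W (branch n (rev u) w))%E.
Proof.
move=> un mW W0.
have m1 : measurable_fun setT (@rev_tuple_mx n \o branch n u).
  by apply: measurableT_comp; [exact: measurable_rev_tuple|exact: measurable_branch].
have m2 : measurable_fun setT (branch n (rev u)) by exact: measurable_branch.
transitivity (\int[pushforward P (@rev_tuple_mx n \o branch n u)]_z W z)%E.
  by rewrite ge0_integral_pushforward.
transitivity (\int[pushforward P (branch n (rev u))]_z W z)%E; last first.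
  by rewrite ge0_integral_pushforward.
apply: eq_measure_integral => A mA _.
apply: tuple_measure_unique mA.
  by rewrite [ltLHS](_ : _ = P setT)// probability_setT ltry.
move=> B mB; rewrite /pushforward /=.
transitivity (P [set w | forall k, B (rev_ord k) (tnth (branch n u w) k)]).
  congr (P _); apply/seteqP; split=> w wB k.
    by have := wB (rev_ord k); rewrite tnth_rev_tuple rev_ordK.
  by have := wB (rev_ord k); rewrite tnth_rev_tuple rev_ordK.
transitivity (P [set w | forall k, B k (tnth (branch n (rev u) w) k)]); last by [].
rewrite (@branch_box n u (fun k => B (rev_ord k)))// branch_box ?size_rev// [LHS](reindex_inj rev_ord_inj)/=.
apply: eq_bigr => k _; congr (P _); apply/seteqP.
by split=> w /=; rewrite rev_ordK nth_rev un.
Qed.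

Lemma allowable_neq0 (A : 'M[R]_d) : allowable A -> A != 0.
Proof.
move=> [_ + _] => /(_ (Ordinal d_gt0))[j].
by apply: contraTneq => ->; rewrite mxE ltxx.
Qed.

(** The zero matrix is not allowable, so it marks the end of the offspring. *)
Lemma offspring_neq0 v w (j : nat) :
  (offspring N g v w j != 0) = lt_enat j (N v w).
Proof.
rewrite /offspring; case: ifP => [lt|_]; last by rewrite eqxx.
by rewrite allowable_neq0//; exact: (brw_allowable brw).
Qed.

Lemma take_succ u k : (k < size u)%N -> rcons (take k u) (nth 0%N u k) = take k.+1 u.
Proof. by move=> ku; rewrite -take_nth. Qed.

Lemma branch_alive n u w : size u = n ->
  `[< alive N w u >] = [forall k, tnth (branch n u w) k != 0].
Proof.
move=> un; apply/asboolP/forallP => [al k|al k].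
  by rewrite tnth_branch offspring_neq0 al// un.
by rewrite un => kn; have := al (Ordinal kn); rewrite tnth_branch offspring_neq0.
Qed.

Lemma branch_lineage n u w : size u = n -> alive N w u ->
  branch n u w = lineage g n u w.
Proof.
move=> un al; apply: eq_from_tnth => k; rewrite tnth_branch tnth_mktuple.
by rewrite /offspring al ?un// take_succ// un.
Qed.

Lemma lineage_allowable n u w : generation N n w u ->
  forall k : 'M[R]_d, k \in (lineage g n u w : seq 'M[R]_d) -> allowable k.
Proof.
move=> [un al] k /mapP[i _ ->]; rewrite -take_succ ?un//.
by apply: (brw_allowable brw); rewrite al ?un.
Qed.

Lemma tree_prod_lineage n u w : size u = n ->
  tree_prod g u w = mprod (lineage g n u w : seq 'M[R]_d).
Proof.
move=> un; rewrite /tree_prod un; congr mprod.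
by rewrite /= -val_enum_ord -map_comp.
Qed.

Definition alive_part n (V : n.-tuple mx -> R) (z : n.-tuple mx) : \bar R :=
  if [forall k, tnth z k != 0] then (V z)%:E else 0%E.

Lemma alive_part_ge0 n V z : (forall z, 0 <= V z) -> (0 <= @alive_part n V z)%E.
Proof. by move=> V0; rewrite /alive_part; case: ifP; rewrite // lee_fin. Qed.

Lemma measurable_alive_part n (V : n.-tuple mx -> R) : measurable_fun setT V ->
  measurable_fun setT (alive_part V).
Proof.
move=> mV; apply: measurable_fun_ifT => //; last exact/measurable_EFinP.
apply: (measurable_fun_bool true).
rewrite setTI [X in measurable X](_ : _ = \bigcap_(k in [set: 'I_n])
  ((fun z : n.-tuple mx => tnth z k) @^-1` (~` [set (0 : 'M[R]_d)]))).
  apply: fin_bigcap_measurable => // k _; rewrite -[_ @^-1` _]setTI.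
  by apply: measurable_tnth => //; apply: measurableC; exact: measurable_zero_mx.
apply/seteqP; split => [z /forallP zk k _ /=|z zk]; first exact/eqP.
by apply/forallP => k; apply/eqP; exact: zk.
Qed.

Lemma gen_sum_ge0 n w (F : seq nat -> R) :
  (forall u, generation N n w u -> 0 <= F u) ->
  gen_sum N n w F = \esum_(u in generation N n w) (F u)%:E.
Proof.
move=> F0; rewrite /gen_sum [X in (_ - X)%E]esum1 ?sube0.
  by apply: eq_esum => u /F0 Fu; rewrite max_l.
by move=> u /F0 Fu; rewrite max_r// oppr_le0.
Qed.

(** The sum over the random generation is a sum over all words, in which the words
    that are not alive are discarded by a measurable function of their branch. *)
Lemma integral_lineages n (V : n.-tuple mx -> R) :
  measurable_fun setT V -> (forall z, 0 <= V z) ->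
  (\int[P]_w (\esum_(u in generation N n w) (V (lineage g n u w))%:E) =
   \esum_(u in [set u | size u = n]) (\int[P]_w alive_part V (branch n u w)))%E.
Proof.
move=> mV V0; rewrite -integral_esum_countable; last 2 first.
- move=> u; apply: (measurableT_comp (measurable_alive_part mV)).
  exact: measurable_branch.
- by move=> u w; exact: alive_part_ge0.
apply: eq_integral => w _.
rewrite (_ : generation N n w = [set u | size u = n] `&` [set u | alive N w u])//.
rewrite esum_mkcondr; apply: eq_esum => u un.
rewrite /alive_part -branch_alive//.
case: (pselect (alive N w u)) => al.
  by rewrite mem_set// asboolT// branch_lineage.
by rewrite memNset// asboolF.
Qed.

Section Support.
Variable Gamma : set 'M[R]_d.
Hypothesis mGamma : measurable (Gamma : set mx).
Hypothesis Gamma_carries : carries_first_generation P N g Gamma.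

(** The first generation is carried by [Gamma], and all nodes reproduce with the
    same law. *)
Lemma branch_in_support n u : size u = n ->
  {ae P, forall w, forall k, tnth (branch n u w) k != 0 ->
     Gamma (tnth (branch n u w) k)}.
Proof.
move=> un.
pose bad : set mx := ~` (Gamma `|` [set (0 : 'M[R]_d)]).
have mbad : measurable bad.
  by apply: measurableC; apply: measurableU => //; exact: measurable_zero_mx.
have root0 j : P [set w | bad (offspring N g [::] w j)] = 0%E.
  apply: measure_negligible.
    by have := @measurable_offspring [::] j measurableT _ mbad; rewrite setTI.
  apply: negligibleS Gamma_carries => w /= wbad wG; apply: wbad.
  have [->|o0] := eqVneq (offspring N g [::] w j) 0; first by right.
  move: (o0); rewrite offspring_neq0 => lt; left; rewrite /offspring lt.
  have -> : g (rcons [::] j) w = tree_prod g [:: j] w by rewrite /tree_prod /= mprod1.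
  by apply: wG; split=> // k; rewrite ltnS leqn0 => /eqP ->.
have any0 v j : P [set w | bad (offspring N g v w j)] = 0%E.
  rewrite -(root0 j).
  exact: (brw_identically_distributed brw v (measurable_coord j mbad)).
apply: (negligibleS (A := \bigcup_k [set w | bad (offspring N g (take k u) w (nth 0%N u k))])).
  move=> w /= /existsNP[k /not_implyP[znz nG]]; exists (nat_of_ord k) => //=.
  by move: znz nG; rewrite tnth_branch => /eqP z0 nG [/nG|/z0].
apply: negligible_bigcup => k; exists [set w | bad (offspring N g (take k u) w (nth 0%N u k))].
split=> //; last exact: any0.
by have := @measurable_offspring (take k u) (nth 0%N u k) measurableT _ mbad; rewrite setTI.
Qed.

(** Reversal permutes the words of length [n] and reverses their branches in law,
    so it is enough to compare [V1] and [V2] along reversed sequences. The bounds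
    [V1] and [V2] are measurable functions of the lineage, whereas [F1] and [F2]
    will contain the eigenfunctions. *)
Lemma gen_sum_reversal_le n (F1 F2 : seq nat -> Omega -> R) (V1 V2 : n.-tuple mx -> R) :
  measurable_fun setT V1 -> measurable_fun setT V2 ->
  (forall z, 0 <= V1 z) -> (forall z, 0 <= V2 z) ->
  (forall w u, generation N n w u -> 0 <= F1 u w <= V1 (lineage g n u w)) ->
  (forall w u, generation N n w u -> V2 (lineage g n u w) <= F2 u w) ->
  (forall z : n.-tuple mx, (forall k, Gamma (tnth z k)) -> V1 z <= V2 (rev_tuple_mx z)) ->
  (\int[P]_w gen_sum N n w (F1^~ w) <= \int[P]_w gen_sum N n w (F2^~ w))%E.
Proof.
move=> mV1 mV2 V10 V20 F1V1 V2F2 V12.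
have F10 w u : generation N n w u -> 0 <= F1 u w by case/F1V1/andP.
have F20 w u : generation N n w u -> 0 <= F2 u w by move/V2F2; exact: le_trans.
apply: (@le_trans _ _ (\int[P]_w (\esum_(u in generation N n w) (V1 (lineage g n u w))%:E))%E).
  apply: ge0_le_lower_integral => w; rewrite gen_sum_ge0; try exact: F10.
    by apply: esum_ge0 => u /F10; rewrite lee_fin.
  by apply: le_esum => u /F1V1/andP[_]; rewrite lee_fin.
apply: (@le_trans _ _ (\int[P]_w (\esum_(u in generation N n w) (V2 (lineage g n u w))%:E))%E); last first.
  apply: ge0_le_lower_integral => w.
    by apply: esum_ge0 => u _; rewrite lee_fin.
  rewrite gen_sum_ge0; last exact: F20.
  by apply: le_esum => u /V2F2; rewrite lee_fin.
rewrite !integral_lineages//.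
rewrite [leRHS](reindex_esum [set u | size u = n] _ rev); last first.
  split=> [u /= <-|u v _ _|u /= <-]; first by rewrite size_rev.
    by move/(can_inj revK).
  by exists (rev u); rewrite ?revK//= size_rev.
apply: le_esum => u un; rewrite -branch_reversal//; last 2 first.
- exact: measurable_alive_part.
- by move=> z; exact: alive_part_ge0.
apply: ae_ge0_le_integral => //.
- by move=> w _; exact: alive_part_ge0.
- by apply: measurableT_comp; [exact: measurable_alive_part|exact: measurable_branch].
- by move=> w _; exact: alive_part_ge0.
- apply: measurableT_comp; first exact: measurable_alive_part.
  by apply: measurableT_comp; [exact: measurable_rev_tuple|exact: measurable_branch].
- apply: filterS (branch_in_support un) => w wG _; rewrite /alive_part.
  have -> : [forall k, tnth (rev_tuple_mx (branch n u w)) k != 0] =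
            [forall k, tnth (branch n u w) k != 0].
    apply/forallP/forallP => z0 k; have := z0 (rev_ord k).
      by rewrite tnth_rev_tuple rev_ordK.
    by rewrite tnth_rev_tuple.
  by case: forallP => // z0; rewrite lee_fin; apply: V12 => k; exact: wG.
Qed.

End Support.
End Branches.

(** * Ladder epochs as records *)

Section Records.
Variable R : realType.
Implicit Types (s : nat -> R) (A : set R) (y : R).

Lemma enat_infP (B : set nat) k :
  enat_inf B = Some k <-> B k /\ forall j, (j < k)%N -> ~ B j.
Proof.
rewrite /enat_inf; case: pselect => [ex|nex]; last first.
  by split=> // -[Bk _]; case: nex; exists k; exact/asboolP.
case: ex_minnP => m /asboolP Bm min_m; split=> [[<-]|[Bk nB]].
  by split=> // j jm /asboolP /min_m; rewrite leqNgt jm.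
congr Some; apply/eqP; rewrite eqn_leq min_m ?asboolT//= leqNgt.
by apply/negP => /nB.
Qed.

Lemma lt_enat_inf (B : set nat) n : lt_enat n (enat_inf B) <-> forall j, (j <= n)%N -> ~ B j.
Proof.
rewrite /enat_inf; case: pselect => [ex|nex]; last first.
  by split=> // _ j _ Bj; apply: nex; exists j; exact/asboolP.
case: ex_minnP => m /asboolP Bm min_m; split=> [nm j jn /asboolP/min_m mj|nB].
  by move: nm; rewrite /= ltnNge (leq_trans mj jn).
by rewrite /= ltnNge; apply/negP => /nB.
Qed.

Definition stays y s n : Prop := forall j, (0 < j <= n)%N -> 0 <= s j + y.

Definition is_record s n : Prop := forall j, (j < n)%N -> s j <= s n.

Lemma lt_tau_minus y s n : lt_enat n (tau_minus y s) <-> stays y s n.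
Proof.
rewrite lt_enat_inf; split=> [nB j /andP[j0 jn]|st j jn [j0]].
  by rewrite leNgt; apply/negP => sj; apply: (nB j).
by rewrite ltNge st// j0.
Qed.

Lemma tau_plus_opp y s : tau_plus y s = tau_minus y (fun n => - s n).
Proof.
rewrite /tau_plus /tau_minus; congr enat_inf; apply/seteqP.
by split=> j /=; rewrite subr_gt0 addrC subr_lt0.
Qed.

Lemma ladder_minus_opp s : ladder_minus s = ladder_plus (fun n => - s n).
Proof.
apply/funext; elim=> // n IH /=; rewrite IH; case: ladder_plus => // k.
congr enat_inf; apply/seteqP.
by split=> j /=; rewrite lerN2.
Qed.

Lemma visits_before_tau_minus y s A :
  visits_before (tau_minus y s) A s =
  \esum_(n in [set: nat]) (\1_[set n | stays y s n /\ A (s n)] n)%:E.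
Proof.
rewrite /visits_before esum_mkcond; apply: eq_esum => n _.
case: ifPn => [/set_mem/lt_tau_minus st|/negP nst]; rewrite !indicE.
  congr (_%:R%:E); congr nat_of_bool.
  by apply/idP/idP => /set_mem /= An; apply/mem_set => //; case: An.
rewrite memNset// => -[st _]; apply: nst; apply/mem_set; exact/lt_tau_minus.
Qed.

(** Between two consecutive ladder epochs the path is below its value at the first
    one. *)
Lemma ladder_plus_record s n k : ladder_plus s n = Some k -> is_record s k.
Proof.
elim: n k => [|n IH] k /=; first by case=> <-.
case E : ladder_plus => [l|//] /enat_infP[[lk sk] below] j jk.
have := IH _ E; case: (ltngtP j l) => [jl /(_ _ jl)|lj _|-> _ //].
  by move/le_trans; apply.
apply: le_trans sk; rewrite leNgt; apply/negP => sj.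
by apply: (below j jk); split=> //; exact: ltW.
Qed.

Lemma ladder_plus_lt s m n k : (m < n)%N -> ladder_plus s n = Some k ->
  exists2 l, ladder_plus s m = Some l & (l < k)%N.
Proof.
elim: n k => // n IH k; rewrite ltnS leq_eqVlt => mn /=.
case E : ladder_plus => [l|//] /enat_infP[[lk _] _].
case/orP: mn => [/eqP->|mn]; first by exists l.
by have [l' ml' l'l] := IH _ mn E; exists l' => //; exact: ltn_trans lk.
Qed.

Lemma record_ladder_plus s k : is_record s k -> exists n, ladder_plus s n = Some k.
Proof.
move=> rk.
(* The ladder epochs increase strictly, and none jumps over the record k. *)
suff: forall m n l, ladder_plus s n = Some l -> (l <= k)%N -> (k - l <= m)%N ->
    exists n', ladder_plus s n' = Some k.
  by move/(_ k 0%N 0%N); apply; rewrite ?subn0.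
elim=> [|m IH] n l nl lk klm.
  by exists n; rewrite nl; congr Some; apply/eqP; rewrite eqn_leq lk -subn_eq0 -leqn0.
move: lk; rewrite leq_eqVlt => /predU1P[<-|lk]; first by exists n.
have [B|E] := pselect (exists j, (ladder_plus s n.+1 = Some j) /\ (l < j <= k)%N).
  case: B => j [nj /andP[lj jk]]; apply: (IH _ _ nj jk).
  by rewrite -ltnS (leq_trans _ klm)// ltn_sub2l// (leq_trans lj).
exfalso; apply: E.
case E' : (ladder_plus s n.+1) => [j|].
  exists j; split=> //; move: E'; rewrite /= nl => /enat_infP[[lj _] below].
  rewrite lj leqNgt; apply/negP => /below; apply; split=> //; exact: rk.
suff : lt_enat k (ladder_plus s n.+1).
  by rewrite /= nl => /lt_enat_inf/(_ k (leqnn k)); case; split=> //; exact: rk.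
by rewrite E'.
Qed.

(** The ladder epochs enumerate the record times without repetition. *)
Lemma ladder_visits_records s A :
  ladder_visits (ladder_plus s) A s =
  \esum_(n in [set: nat]) (\1_[set n | is_record s n /\ A (s n)] n)%:E.
Proof.
pose T := ladder_plus s; pose f k : \bar R := (\1_A (s k))%:E.
transitivity (\esum_(j in [set j | exists k, T j = Some k]) f (odflt 0%N (T j))).
  rewrite [RHS]esum_mkcond; apply: eq_esum => j _; rewrite -/T.
  case E : (T j) => [k|]; first by rewrite mem_set//; exists k.
  by rewrite memNset// => -[k]; rewrite E.
rewrite -(reindex_esum _ [set k | is_record s k]); last first.
  split=> [j [k jk]|i j|k rk].
  - by rewrite /= jk; exact: ladder_plus_record jk.
  - move=> /set_mem[k ik] /set_mem[l jl]; rewrite ik jl /= => kl.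
    rewrite kl in ik; case: (ltngtP i j) => // [ij|ji].
      by have [l' ] := ladder_plus_lt ij jl; rewrite -/T ik => -[<-]; rewrite ltnn.
    by have [l' ] := ladder_plus_lt ji ik; rewrite -/T jl => -[<-]; rewrite ltnn.
  - by have [n nk] := record_ladder_plus rk; exists n; [exists k|rewrite /= /T nk].
rewrite esum_mkcond; apply: eq_esum => n _; rewrite /f.
case: ifPn => [/set_mem rn|/negP nr]; rewrite !indicE.
  congr (_%:R%:E); congr nat_of_bool.
  by apply/idP/idP => /set_mem /= An; apply/mem_set => //; case: An.
by rewrite memNset// => -[rn _]; apply: nr; apply/mem_set.
Qed.

End Records.

(** * Duality of the stay and record events *)

Section Events.
Variables (R : realType) (d : nat).
Local Notation mx := (borel_mx R d).
Implicit Types (x y : 'cV[R]_d) (A : set R) (s : seq 'M[R]_d).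

Definition positions (e : R) x s (j : nat) : R := position e x (take j s).

Definition stay_event e x (b : R) A s : Prop :=
  stays b (positions e x s) (size s) /\ A (position e x s).

Definition record_event e x A s : Prop :=
  is_record (positions e x s) (size s) /\ A (position e x s).

Let measurable_position_set n e x A : measurable A ->
  measurable [set z : n.-tuple mx | A (position e x (z : seq 'M[R]_d))].
Proof.
move=> mA; rewrite -[X in measurable X]setTI.
have := @measurable_position_take R d n n e x (leqnn n) measurableT _ mA.
by congr (measurable (_ `&` _)); apply/seteqP; split=> z /=;
  rewrite take_oversize ?size_tuple.
Qed.

Lemma measurable_stay_event n e x b A : measurable A ->
  measurable [set z : n.-tuple mx | stay_event e x b A (z : seq 'M[R]_d)].
Proof.
move=> mA.
have -> : [set z : n.-tuple mx | stay_event e x b A (z : seq 'M[R]_d)] =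
    (\bigcap_(j in [set j | (0 < j <= n)%N]) ((fun z : n.-tuple mx =>
      positions e x (z : seq 'M[R]_d) j) @^-1` `[- b, +oo[%classic)) `&`
    [set z : n.-tuple mx | A (position e x (z : seq 'M[R]_d))].
  apply/seteqP; split=> z [zs zA]; split=> // j.
    by rewrite /= in_itv /= andbT => jn; rewrite lerNl -subr_ge0 opprK addrC zs// size_tuple.
  rewrite size_tuple => jn; have := zs j jn.
  by rewrite /= in_itv /= andbT lerNl -subr_ge0 opprK addrC.
apply: measurableI; last exact: measurable_position_set.
apply: bigcap_measurableType => j /andP[_ jn]; rewrite -[X in measurable X]setTI.
exact: (@measurable_position_take R d n j e x jn).
Qed.

Lemma measurable_record_event n e x A : measurable A ->
  measurable [set z : n.-tuple mx | record_event e x A (z : seq 'M[R]_d)].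
Proof.
move=> mA.
have -> : [set z : n.-tuple mx | record_event e x A (z : seq 'M[R]_d)] =
    (\bigcap_(j in [set j | (j < n)%N]) ((fun z : n.-tuple mx =>
      position e x (take n (z : seq 'M[R]_d)) - position e x (take j (z : seq 'M[R]_d)))
        @^-1` `[0, +oo[%classic)) `&`
    [set z : n.-tuple mx | A (position e x (z : seq 'M[R]_d))].
  apply/seteqP; split=> z [zs zA]; split=> // j.
    rewrite /= in_itv /= andbT subr_ge0 => jn.
    by have := zs j; rewrite size_tuple => /(_ jn).
  rewrite /positions size_tuple => jn; have := zs j jn.
  by rewrite /= in_itv /= andbT subr_ge0.
apply: measurableI; last exact: measurable_position_set.
apply: bigcap_measurableType => j /ltnW jn; rewrite -[X in measurable X]setTI.
by apply: measurable_funB => //; exact: measurable_position_take.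
Qed.

Section Duality.
Variables (kappa : R) (Gamma : set 'M[R]_d).
Hypotheses (FK : furstenberg_kesten kappa Gamma)
  (Gamma_mul : forall g1 g2, Gamma g1 -> Gamma g2 -> Gamma (g1 *m g2))
  (Gamma_allowable : Gamma `<=` @allowable R d).
Variables (e c1 : R).
Hypotheses (e1 : `|e| <= 1) (c1_ge : ln kappa <= c1).

Lemma position_distortion x y s : (forall g, g \in s -> Gamma g) ->
  sphere x -> sphere y ->
  `|position e x s - position e y (dual_seq s)| <= c1.
Proof.
move=> sG sx sy; apply: le_trans c1_ge.
apply: le_trans (dual_norm_distortion FK Gamma_mul Gamma_allowable sG sx sy).
rewrite /position -mulrBr normrM opprK addrC distrC.
by rewrite ler_piMl.
Qed.

Let GammaT g : Gamma g -> allowable g^T.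
Proof. by move=> /Gamma_allowable/allowable_tr. Qed.

(** By the cocycle property, the increment of the dual walk from the time [i] on is
    a position of the walk driven by the remaining transposes, started at a new
    point of the sphere; these transposes are the dual sequence of an initial
    segment of [s]. *)
Lemma dual_increment_distortion x y s i : (forall g, g \in s -> Gamma g) ->
  sphere x -> sphere y ->
  `|positions e x s (size s - i)
    - (position e y (dual_seq s) - positions e y (dual_seq s) i)| <= c1.
Proof.
move=> sG sx sy.
have dG g : g \in dual_seq s -> allowable g.
  by rewrite mem_rev => /mapP[k /sG /GammaT ak ->].
have tG g : g \in take i (dual_seq s) -> allowable g by move/mem_take/dG.
have -> : position e y (dual_seq s) - positions e y (dual_seq s) i =
    position e (act (mprod (take i (dual_seq s))) y) (dual_seq (take (size s - i) s)).
  rewrite -{1}(cat_take_drop i (dual_seq s)) position_cat//; last first.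
    by move=> g /mem_drop/dG.
  by rewrite /positions addrC addKr drop_dual_seq.
apply: position_distortion => //; first by move=> g /mem_take/sG.
apply: sphere_act => //; exact: allowable_mprod.
Qed.

Lemma record_stay x y t a s : (forall g, g \in s -> Gamma g) ->
  sphere x -> sphere y ->
  record_event e y `[t + c1, t + a - c1]%classic (dual_seq s) ->
  stay_event e x c1 `[t, t + a]%classic s.
Proof.
move=> sG sx sy [rec]; rewrite /= in_itv /= => /andP[ta tb]; split=> [j /andP[j0 jn]|].
  have := dual_increment_distortion (size s - j) sG sx sy.
  rewrite subKn// ler_norml => /andP[+ _].
  have := rec (size s - j)%N; rewrite size_dual_seq ltn_subrL j0 (leq_trans j0 jn).
  move=> /(_ isT); rewrite {2}/positions take_oversize ?size_dual_seq//.
  rewrite -subr_ge0; lra.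
rewrite /= in_itv /=; have := position_distortion sG sx sy.
by rewrite ler_norml => /andP[]; move: ta tb; lra.
Qed.

Lemma stay_record x y t a s : (forall g, g \in s -> Gamma g) ->
  sphere x -> sphere y ->
  stay_event e x (- c1) `[t, t + a]%classic s ->
  record_event e y `[t - c1, t + a + c1]%classic (dual_seq s).
Proof.
move=> sG sx sy [st]; rewrite /= in_itv /= => /andP[ta tb]; split=> [i|].
  rewrite size_dual_seq => ilt; rewrite {2}/positions take_oversize ?size_dual_seq//.
  have := dual_increment_distortion i sG sx sy.
  rewrite ler_norml => /andP[_].
  have := st (size s - i)%N; rewrite subn_gt0 ilt leq_subr => /(_ isT).
  lra.
rewrite /= in_itv /=; have := position_distortion sG sx sy.
by rewrite ler_norml => /andP[]; move: ta tb; lra.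
Qed.

End Duality.
End Events.

(** * Comparison of the two laws *)

Section Laws.
Variables (R : realType) (d : nat).
Hypothesis d_gt0 : (0 < d)%N.
Variables (disp : measure_display) (Omega : measurableType disp).
Variables (P : probability Omega R).
Variables (N : seq nat -> Omega -> enat) (g : seq nat -> Omega -> 'M[R]_d).
Hypothesis brw : matrix_brw P N g.
Variable Gamma : set 'M[R]_d.
Local Notation mx := (borel_mx R d).
Hypothesis mGamma : measurable (Gamma : set mx).
Hypothesis Gamma_carries : carries_first_generation P N g Gamma.

Lemma val_prefix_tuple disp' (Omega' : measurableType disp')
    (h : nat -> Omega' -> 'M[R]_d) n w :
  (prefix_tuple h n w : seq 'M[R]_d) = [seq h i w | i <- iota 0 n].
Proof. by rewrite /= -val_enum_ord -map_comp. Qed.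

Lemma measurable_prefix_tuple disp' (Omega' : measurableType disp')
    (h : nat -> Omega' -> 'M[R]_d) n :
  (forall i, measurable_fun setT (h i : Omega' -> mx)) ->
  measurable_fun setT (prefix_tuple h n).
Proof.
move=> mh; apply/measurable_fun_tnthP => k.
by apply: (eq_measurable_fun (h k : Omega' -> mx)) => // w _; rewrite /= tnth_mktuple.
Qed.

(** The common shape of the laws of the original and of the dual walk: the first
    [n] matrices are those of a lineage, read through [iota] (the identity or the
    transposition), under the change of measure with density [D]. This density
    contains an eigenfunction with values between [m] and [M]; [W] is what remains
    of it. *)
Record biased_law (m M : R) n disp' (Omega' : measurableType disp')
    (Q : probability Omega' R) (h : nat -> Omega' -> 'M[R]_d)
    (W : n.-tuple mx -> R) (iota : n.-tuple mx -> n.-tuple mx) : Prop := BiasedLaw {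
  biased_measurable : forall i, measurable_fun setT (h i : Omega' -> mx) ;
  biased_iota : measurable_fun setT iota ;
  biased_weight : measurable_fun setT W ;
  biased_weight_ge0 : forall z, 0 <= W z ;
  biased_density : exists2 a : R, m <= a <= M &
    exists2 D : seq nat -> Omega -> R,
      (forall w u, generation N n w u ->
        m * W (lineage g n u w) <= D u w <= M * W (lineage g n u w)) &
      forall f : n.-tuple mx -> R, measurable_fun setT f ->
        (exists M, forall z, `|f z| <= M) ->
        (\int[Q]_w (f (prefix_tuple h n w))%:E =
         a^-1%:E * \int[P]_w gen_sum N n w
           (fun u => (D u w * f (iota (lineage g n u w)))%R))%E }.

(** Reversal preserves the intensity of the lineages, and the densities of both
    laws are comparable to weights that are compared along reversed sequences. One
    factor [M / m] comes from the normalizations [a], the other one from the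
    densities. *)
Lemma biased_law_le (m M k : R) n
    disp1 (Omega1 : measurableType disp1) (Q1 : probability Omega1 R) h1 W1 iota1
    disp2 (Omega2 : measurableType disp2) (Q2 : probability Omega2 R) h2 W2 iota2
    (E1 E2 : set (n.-tuple mx)) :
  0 < m -> 0 <= k ->
  biased_law m M Q1 h1 W1 iota1 -> biased_law m M Q2 h2 W2 iota2 ->
  measurable E1 -> measurable E2 ->
  (forall z : n.-tuple mx, (forall i, Gamma (tnth z i)) ->
    W1 z <= k * W2 (rev_tuple_mx z)) ->
  (forall z : n.-tuple mx, (forall i, Gamma (tnth z i)) ->
    E1 (iota1 z) -> E2 (iota2 (rev_tuple_mx z))) ->
  (\int[Q1]_w (\1_E1 (prefix_tuple h1 n w))%:E <=
   (M / m * (M * k / m))%:E * \int[Q2]_w (\1_E2 (prefix_tuple h2 n w))%:E)%E.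
Proof.
move=> m0 k0 [mh1 mi1 mW1 W10 [a1 /andP[ma1 a1M] [D1 D1W law1]]]
  [mh2 mi2 mW2 W20 [a2 /andP[ma2 a2M] [D2 D2W law2]]] mE1 mE2 W12 E12.
have a10 : 0 < a1 by exact: lt_le_trans ma1.
have a20 : 0 < a2 by exact: lt_le_trans ma2.
have M0 : 0 < M by exact: lt_le_trans a1M.
(* The factor that makes the lower bound of the second density, multiplied by c,
   equal to the upper bound M k W2 of the first one. *)
set c := M * k / m; have c0 : 0 <= c by rewrite /c divr_ge0 ?mulr_ge0// ltW.
have mind (E : set (n.-tuple mx)) : measurable E ->
    measurable_fun setT (\1_E : n.-tuple mx -> R) by exact: measurable_indic.
have ind1 (E : set (n.-tuple mx)) z : `|\1_E z : R| <= 1.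
  by rewrite indicE; case: (_ \in _); rewrite ?normr0 ?normr1.
have ind0 (E : set (n.-tuple mx)) z : 0 <= \1_E z :> R by [].
have MW1 z : 0 <= M * W1 z by apply: mulr_ge0 => //; exact: ltW.
have mW10 z : 0 <= m * W1 z by apply: mulr_ge0 => //; exact: ltW.
have V20 z : 0 <= m * W2 z * (c * \1_E2 (iota2 z)).
  by apply: mulr_ge0; apply: mulr_ge0 => //; exact: ltW.
rewrite law1; [|exact: mind|by exists 1].
have law2c : (\int[Q2]_w (c * \1_E2 (prefix_tuple h2 n w))%:E = a2^-1%:E *
    \int[P]_w gen_sum N n w (fun u => (D2 u w * (c * \1_E2 (iota2 (lineage g n u w))))%R))%E.
  apply: (law2 (fun z => c * \1_E2 z)).
    by apply: measurable_funM; [exact: measurable_cst|exact: mind].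
  by exists c => z; rewrite normrM ger0_norm// ler_piMr.
have X2 : (\int[P]_w gen_sum N n w (fun u => (D2 u w * (c * \1_E2 (iota2 (lineage g n u w))))%R)
    = (a2 * c)%:E * \int[Q2]_w (\1_E2 (prefix_tuple h2 n w))%:E)%E.
  have -> : ((a2 * c)%:E * \int[Q2]_w (\1_E2 (prefix_tuple h2 n w))%:E =
      a2%:E * \int[Q2]_w (c * \1_E2 (prefix_tuple h2 n w))%:E)%E.
    rewrite EFinM -muleA; congr (_ * _)%E.
    under [RHS]eq_integral do rewrite EFinM.
    rewrite ge0_integralZl//.
    by apply/measurable_EFinP; apply: measurableT_comp; [exact: mind|exact: measurable_prefix_tuple].
  rewrite law2c.
  by rewrite muleA -EFinM divff ?gt_eqF// mul1e.
apply: (@le_trans _ _ (a1^-1%:E * ((a2 * c)%:E * \int[Q2]_w (\1_E2 (prefix_tuple h2 n w))%:E))%E).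
  apply: lee_wpmul2l; first by rewrite lee_fin invr_ge0 ltW.
  rewrite -X2.
  apply: (gen_sum_reversal_le d_gt0 brw mGamma Gamma_carries
    (V1 := fun z => M * W1 z * \1_E1 (iota1 z))
    (V2 := fun z => m * W2 z * (c * \1_E2 (iota2 z)))).
  - apply: measurable_funM; last by apply: measurableT_comp => //; exact: mind.
    by apply: measurable_funM => //; exact: measurable_cst.
  - apply: measurable_funM; first by apply: measurable_funM => //; exact: measurable_cst.
    apply: measurable_funM; first exact: measurable_cst.
    by apply: measurableT_comp => //; exact: mind.
  - by move=> z; apply: mulr_ge0 => //; exact: MW1.
  - exact: V20.
  - move=> w u /D1W/andP[lo up]; rewrite mulr_ge0 ?ler_wpM2r//.
    exact: le_trans lo.
  - by move=> w u /D2W/andP[lo up]; rewrite ler_wpM2r// mulr_ge0.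
  - move=> z Gz; rewrite [in leLHS]indicE; case: (boolP (iota1 z \in E1)); last first.
      by move=> _; rewrite mulr0; exact: V20.
    move=> /set_mem/(E12 z Gz)/mem_set zE2; rewrite indicE zE2 !mulr1.
    rewrite /c (_ : _ * _ * _ = M * (k * W2 (rev_tuple_mx z))); last by field; rewrite gt_eqF.
    by apply: ler_wpM2l; [exact: ltW|exact: W12].
rewrite muleA -EFinM lee_wpmul2r//.
  by apply: integral_ge0 => w _; rewrite lee_fin.
rewrite lee_fin mulrA ler_wpM2r// mulrC.
by apply: ler_pM => //; [exact: ltW|rewrite invr_ge0 ltW|rewrite lef_pV2].
Qed.

End Laws.

Section Comparison.
Variables (R : realType) (d : nat).
Hypothesis d_gt0 : (0 < d)%N.
Variables (disp : measure_display) (Omega : measurableType disp).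
Variables (P : probability Omega R).
Variables (N : seq nat -> Omega -> enat) (g : seq nat -> Omega -> 'M[R]_d).
Hypothesis brw : matrix_brw P N g.
Variables (Gamma : set 'M[R]_d) (kappa alpha m M : R) (r rs : 'cV[R]_d -> R).
Local Notation mx := (borel_mx R d).
Hypotheses (mGamma : measurable (Gamma : set mx))
  (Gamma_carries : carries_first_generation P N g Gamma)
  (FK : furstenberg_kesten kappa Gamma)
  (Gamma_mul : forall g1 g2, Gamma g1 -> Gamma g2 -> Gamma (g1 *m g2))
  (Gamma_allowable : Gamma `<=` @allowable R d).
Hypotheses (alpha_ge0 : 0 <= alpha) (m_gt0 : 0 < m)
  (r_bounds : forall x, sphere x -> m <= r x <= M)
  (rs_bounds : forall x, sphere x -> m <= rs x <= M).
Implicit Types (x y : 'cV[R]_d).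

Definition transpose_tuple n (z : n.-tuple mx) : n.-tuple mx :=
  [tuple of map (fun A : mx => (A : 'M[R]_d)^T : mx) z].

Lemma measurable_transpose_tuple n : measurable_fun setT (@transpose_tuple n).
Proof.
apply/measurable_fun_tnthP => k.
apply: (eq_measurable_fun (fun z : n.-tuple mx => (tnth z k : 'M[R]_d)^T : mx)).
  by move=> z _; rewrite /= tnth_map.
apply: (measurableT_comp (@measurable_trmx R d)); exact: measurable_tnth.
Qed.

Lemma transpose_rev_tuple n (z : n.-tuple mx) :
  (transpose_tuple (rev_tuple_mx z) : seq 'M[R]_d) = dual_seq (z : seq 'M[R]_d).
Proof. by rewrite /dual_seq -map_rev. Qed.

Lemma transpose_lineage n u w : transpose_tuple (lineage g n u w) = lineage_tr g n u w.
Proof. by apply: eq_from_tnth => k; rewrite tnth_map !tnth_mktuple. Qed.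

Definition weight x (s : seq 'M[R]_d) : R := expR (alpha * ln (vnorm (mprod s *m x))).

Lemma measurable_weight n x :
  measurable_fun setT (fun z : n.-tuple mx => weight x (z : seq 'M[R]_d)).
Proof.
apply: measurableT_comp; first exact: measurable_expR.
apply: measurable_funM; first exact: measurable_cst.
apply: measurableT_comp; first exact: measurable_ln.
have := @measurable_vnorm_take R d n n x (leqnn n).
by apply: eq_measurable_fun => z _; rewrite take_oversize// size_tuple.
Qed.

Lemma weight_dual x y s : (forall k, k \in s -> Gamma k) -> sphere x -> sphere y ->
  weight x s <= expR (alpha * ln kappa) * weight y (dual_seq s) /\
  weight y (dual_seq s) <= expR (alpha * ln kappa) * weight x s.
Proof.
move=> sG sx sy.
have := dual_norm_distortion FK Gamma_mul Gamma_allowable sG sx sy.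
rewrite ler_norml => /andP[lo up].
by split; rewrite /weight -expRD ler_expR -mulrDr ler_wpM2l//; lra.
Qed.

Lemma original_biased_law n x disp' (Omega' : measurableType disp')
    (Q : probability Omega' R) h : (0 < n)%N -> sphere x ->
  original_law P N g Q h alpha r x ->
  biased_law P N g m M Q h (fun z : n.-tuple mx => weight x (z : seq 'M[R]_d)) id.
Proof.
move=> n0 sx [mh law]; split=> //.
- exact: measurable_weight.
- by move=> z; exact: expR_ge0.
exists (r x); first exact: r_bounds.
exists (fun u w => expR (- alpha * tree_pos g x u w) * r (tree_dir g x u w)).
  move=> w u gu; rewrite /tree_pos /tree_dir (tree_prod_lineage _ _ gu.1).
  have /allowable_mprod al := lineage_allowable brw gu.
  have /andP[lo up] := r_bounds (sphere_act al sx).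
  rewrite mulrNN [expR _ * r _]mulrC /weight.
  by apply/andP; split; apply: ler_wpM2r => //; exact: expR_ge0.
by move=> f mf bf; exact: law.
Qed.

Lemma dual_biased_law n y disp' (Omega' : measurableType disp')
    (Q : probability Omega' R) h : (0 < n)%N -> sphere y ->
  dual_law P N g Q h alpha rs y ->
  biased_law P N g m M Q h
    (fun z : n.-tuple mx => weight y (transpose_tuple z : seq 'M[R]_d))
    (@transpose_tuple n).
Proof.
move=> n0 sy [mh law]; split=> //.
- exact: measurable_transpose_tuple.
- exact: (measurableT_comp (@measurable_weight n y) (@measurable_transpose_tuple n)).
- by move=> z; exact: expR_ge0.
exists (rs y); first exact: rs_bounds.
exists (fun u w => rs (act (mprod (lineage_tr g n u w : seq 'M[R]_d)) y)
  * vnorm (mprod (lineage_tr g n u w : seq 'M[R]_d) *m y) `^ alpha).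
  move=> w u gu; rewrite transpose_lineage.
  have al : allowable (mprod (lineage_tr g n u w : seq 'M[R]_d)).
    apply: allowable_mprod => k; rewrite -transpose_lineage => /mapP[l lk ->].
    exact/allowable_tr/(lineage_allowable brw gu).
  have /andP[lo up] := rs_bounds (sphere_act al sy).
  rewrite /weight /powR gt_eqF ?allowable_vnorm_gt0//.
  by apply/andP; split; apply: ler_wpM2r => //; exact: expR_ge0.
move=> f mf bf; rewrite (law _ _ n0 mf bf); congr (_ * _)%E.
apply: eq_integral => w _; congr (gen_sum N n w _); apply/funext => u.
by rewrite transpose_lineage.
Qed.

(** The constant of [biased_law_le], with the distortion of the weights. *)
Definition comparison_constant : R := M / m * (M * expR (alpha * ln kappa) / m).

Lemma comparison_constant_ge1 x : sphere x -> 1 <= comparison_constant.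
Proof.
move=> /r_bounds/andP[mr rM]; have mM := le_trans mr rM.
have k1 : 1 <= expR (alpha * ln kappa).
  by rewrite -expR0 ler_expR mulr_ge0// ln_ge0// ltW// FK.1.
have Mm : 1 <= M / m by rewrite ler_pdivlMr// mul1r.
by rewrite /comparison_constant mulr_ege1// mulrAC mulr_ege1.
Qed.

(** The laws of the walks specify nonempty prefixes only; the time 0 contributes a
    deterministic term. *)
Lemma prefix_indic_le0 disp1 (Omega1 : measurableType disp1) (Q1 : probability Omega1 R) h1
   disp2 (Omega2 : measurableType disp2) (Q2 : probability Omega2 R) h2
   (E1 E2 : set (0.-tuple mx)) (C : R) : 1 <= C ->
  (E1 [tuple] -> E2 [tuple]) ->
  (\int[Q1]_w (\1_E1 (prefix_tuple h1 0 w))%:E <=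
   C%:E * \int[Q2]_w (\1_E2 (prefix_tuple h2 0 w))%:E)%E.
Proof.
move=> C1 E12.
under eq_integral do rewrite tuple0.
under [X in (_ <= _ * X)%E]eq_integral do rewrite tuple0.
have cstQ d' (O : measurableType d') (Q0 : probability O R) (c : R) :
    (\int[Q0]_w c%:E = c%:E)%E.
  rewrite integral_cst// [X in (_ * X)%E](_ : _ = 1%E) ?mule1//.
  exact: probability_setT.
rewrite !cstQ -EFinM lee_fin !indicE.
case: (boolP ([tuple] \in E1)) => [/set_mem/E12/mem_set ->|_]; first by rewrite mulr1.
by rewrite mulr_ge0// (le_trans _ C1).
Qed.

Section Walks.
Variables (x y : 'cV[R]_d) (sx : sphere x) (sy : sphere y).
Variables (disp1 : measure_display) (Omega1 : measurableType disp1)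
  (Q : probability Omega1 R) (h : nat -> Omega1 -> 'M[R]_d)
  (disp2 : measure_display) (Omega2 : measurableType disp2)
  (Qs : probability Omega2 R) (hs : nat -> Omega2 -> 'M[R]_d).
Hypotheses (law : original_law P N g Q h alpha r x)
  (dlaw : dual_law P N g Qs hs alpha rs y).
Local Notation C := comparison_constant.

Lemma tnth_Gamma n (z : n.-tuple mx) : (forall i, Gamma (tnth z i)) ->
  forall k : 'M[R]_d, k \in (z : seq 'M[R]_d) -> Gamma k.
Proof. by move=> Gz k /tnthP[i ->]; exact: Gz. Qed.

Lemma original_dual_le n (E1 E2 : set (seq 'M[R]_d)) :
  measurable [set z : n.-tuple mx | E1 z] -> measurable [set z : n.-tuple mx | E2 z] ->
  (forall s, (forall k, k \in s -> Gamma k) -> E1 s -> E2 (dual_seq s)) ->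
  (\int[Q]_w (\1_[set z : n.-tuple mx | E1 z] (prefix_tuple h n w))%:E <=
   C%:E * \int[Qs]_w (\1_[set z : n.-tuple mx | E2 z] (prefix_tuple hs n w))%:E)%E.
Proof.
move=> mE1 mE2 E12; case: n mE1 mE2 => [|n] mE1 mE2.
  by apply: prefix_indic_le0; [exact: comparison_constant_ge1 sx|exact: (E12 [::])].
apply: (biased_law_le d_gt0 brw mGamma Gamma_carries m_gt0 (expR_ge0 _)
  (original_biased_law (ltn0Sn n) sx law) (dual_biased_law (ltn0Sn n) sy dlaw) mE1 mE2).
- move=> z /tnth_Gamma Gz; rewrite transpose_rev_tuple.
  exact: (weight_dual Gz sx sy).1.
- by move=> z /tnth_Gamma Gz; rewrite /= transpose_rev_tuple; exact: E12.
Qed.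

(** Every sequence is the reversal of another one, so the comparison of the densities
    in [original_dual_le] can be read in the other direction. *)
Lemma dual_original_le n (E1 E2 : set (seq 'M[R]_d)) :
  measurable [set z : n.-tuple mx | E1 z] -> measurable [set z : n.-tuple mx | E2 z] ->
  (forall s, (forall k, k \in s -> Gamma k) -> E2 (dual_seq s) -> E1 s) ->
  (\int[Qs]_w (\1_[set z : n.-tuple mx | E2 z] (prefix_tuple hs n w))%:E <=
   C%:E * \int[Q]_w (\1_[set z : n.-tuple mx | E1 z] (prefix_tuple h n w))%:E)%E.
Proof.
move=> mE1 mE2 E21; case: n mE1 mE2 => [|n] mE1 mE2.
  by apply: prefix_indic_le0; [exact: comparison_constant_ge1 sx|exact: (E21 [::])].
have revG (z : n.+1.-tuple mx) : (forall i, Gamma (tnth z i)) ->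
    forall k : 'M[R]_d, k \in (rev z : seq 'M[R]_d) -> Gamma k.
  by move=> Gz k; rewrite mem_rev; exact: tnth_Gamma.
have trE (z : n.+1.-tuple mx) :
    (transpose_tuple z : seq 'M[R]_d) = dual_seq (rev z : seq 'M[R]_d).
  by rewrite /dual_seq map_rev revK.
apply: (biased_law_le d_gt0 brw mGamma Gamma_carries m_gt0 (expR_ge0 _)
  (dual_biased_law (ltn0Sn n) sy dlaw) (original_biased_law (ltn0Sn n) sx law) mE2 mE1).
- by move=> z /revG Gz; rewrite trE; exact: (weight_dual Gz sx sy).2.
- by move=> z /revG Gz; rewrite /= trE; exact: E21.
Qed.

End Walks.
End Comparison.

(** * Expected numbers of visits *)

Section Visits.
Variables (R : realType) (d : nat).
Local Notation mx := (borel_mx R d).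
Variables (disp : measure_display) (Omega : measurableType disp).
Variables (Q : probability Omega R) (h : nat -> Omega -> 'M[R]_d).
Hypothesis mh : forall i, measurable_fun setT (h i : Omega -> mx).
Variables (e : R) (x : 'cV[R]_d).
Let S w n : R := e * walk h x n w.

Lemma positions_prefix n w j : (j <= n)%N ->
  positions e x (prefix_tuple h n w : seq 'M[R]_d) j = S w j.
Proof.
move=> jn; rewrite /positions /position /S /walk val_prefix_tuple -map_take.
by rewrite take_iota (minn_idPl jn).
Qed.

Lemma position_prefix n w :
  position e x (prefix_tuple h n w : seq 'M[R]_d) = S w n.
Proof. by rewrite -(positions_prefix w (leqnn n)) /positions take_oversize ?size_tuple. Qed.

Lemma stay_event_prefix n w b A :
  stay_event e x b A (prefix_tuple h n w : seq 'M[R]_d) <->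
  stays b (S w) n /\ A (S w n).
Proof.
rewrite /stay_event position_prefix size_tuple.
split=> -[st An]; split=> // j jn; have := st j jn;
  by rewrite positions_prefix//; case/andP: jn.
Qed.

Lemma record_event_prefix n w A :
  record_event e x A (prefix_tuple h n w : seq 'M[R]_d) <->
  is_record (S w) n /\ A (S w n).
Proof.
rewrite /record_event position_prefix size_tuple.
by split=> -[rc An]; split=> // j jn; have := rc j jn;
  rewrite !positions_prefix// ltnW.
Qed.

Lemma integral_prefix_events (E : set (seq 'M[R]_d)) (B : Omega -> set nat) :
  (forall n, measurable [set z : n.-tuple mx | E z]) ->
  (forall n w, E (prefix_tuple h n w : seq 'M[R]_d) <-> B w n) ->
  (\int[Q]_w (\esum_(n in [set: nat]) (\1_(B w) n)%:E) =
   \esum_(n in [set: nat])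
     (\int[Q]_w (\1_[set z : n.-tuple mx | E z] (prefix_tuple h n w))%:E))%E.
Proof.
move=> mE EB; rewrite -integral_esum_countable; last 2 first.
- move=> n; apply/measurable_EFinP.
  by apply: (measurableT_comp (measurable_indic (mE n))); exact: measurable_prefix_tuple.
- by move=> n w; rewrite lee_fin.
apply: eq_integral => w _; apply: eq_esum => n _; rewrite !indicE.
congr (_%:R%:E); congr nat_of_bool.
by apply/idP/idP => /set_mem Bn; apply/mem_set/EB.
Qed.

Lemma integral_visits b A : measurable A ->
  (\int[Q]_w visits_before (tau_minus b (S w)) A (S w) =
   \esum_(n in [set: nat]) (\int[Q]_w
     (\1_[set z : n.-tuple mx | stay_event e x b A (z : seq 'M[R]_d)] (prefix_tuple h n w))%:E))%E.
Proof.
move=> mA; under eq_integral do rewrite visits_before_tau_minus.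
apply: (integral_prefix_events (E := stay_event e x b A)
  (B := fun w => [set n | stays b (S w) n /\ A (S w n)])) => n.
  exact: measurable_stay_event.
by move=> w; exact: stay_event_prefix.
Qed.

Lemma integral_ladder_visits A : measurable A ->
  (\int[Q]_w ladder_visits (ladder_plus (S w)) A (S w) =
   \esum_(n in [set: nat]) (\int[Q]_w
     (\1_[set z : n.-tuple mx | record_event e x A (z : seq 'M[R]_d)] (prefix_tuple h n w))%:E))%E.
Proof.
move=> mA; under eq_integral do rewrite ladder_visits_records.
apply: (integral_prefix_events (E := record_event e x A)
  (B := fun w => [set n | is_record (S w) n /\ A (S w n)])) => n.
  exact: measurable_record_event.
by move=> w; exact: record_event_prefix.
Qed.

End Visits.

Lemma le_esum_natZ (R : realType) (C : R) (a b : nat -> \bar R) :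
  0 <= C -> (forall n, 0 <= b n)%E -> (forall n, a n <= C%:E * b n)%E ->
  (\esum_(n in [set: nat]) a n <= C%:E * \esum_(n in [set: nat]) b n)%E.
Proof.
move=> C0 b0 ab; rewrite -(nneseries_esumT b0) -nneseriesZl//.
rewrite nneseries_esumT; first by apply: le_esum.
by move=> n; rewrite mule_ge0.
Qed.

Lemma lee_inv_pmull (R : realType) (C : R) (a b : \bar R) : 0 < C ->
  (a <= C%:E * b -> C^-1%:E * a <= b)%E.
Proof.
move=> C0 ab; have : (C^-1%:E * a <= C^-1%:E * (C%:E * b))%E.
  by apply: lee_wpmul2l => //; rewrite lee_fin invr_ge0 ltW.
by rewrite muleA -EFinM mulVf ?gt_eqF// mul1e.
Qed.

Section Inequalities.
Variables (R : realType) (d : nat).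
Hypothesis d_gt0 : (0 < d)%N.
Variables (disp : measure_display) (Omega : measurableType disp).
Variables (P : probability Omega R).
Variables (N : seq nat -> Omega -> enat) (g : seq nat -> Omega -> 'M[R]_d).
Hypothesis brw : matrix_brw P N g.
Variables (Gamma : set 'M[R]_d) (kappa alpha m M : R) (r rs : 'cV[R]_d -> R).
Local Notation mx := (borel_mx R d).
Hypotheses (mGamma : measurable (Gamma : set mx))
  (Gamma_carries : carries_first_generation P N g Gamma)
  (FK : furstenberg_kesten kappa Gamma)
  (Gamma_mul : forall g1 g2, Gamma g1 -> Gamma g2 -> Gamma (g1 *m g2))
  (Gamma_allowable : Gamma `<=` @allowable R d).
Hypotheses (alpha_ge0 : 0 <= alpha) (m_gt0 : 0 < m)
  (r_bounds : forall x, sphere x -> m <= r x <= M)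
  (rs_bounds : forall x, sphere x -> m <= rs x <= M).
Variables (x y : 'cV[R]_d) (sx : sphere x) (sy : sphere y).
Variables (disp1 : measure_display) (Omega1 : measurableType disp1)
  (Q : probability Omega1 R) (h : nat -> Omega1 -> 'M[R]_d)
  (disp2 : measure_display) (Omega2 : measurableType disp2)
  (Qs : probability Omega2 R) (hs : nat -> Omega2 -> 'M[R]_d).
Hypotheses (law : original_law P N g Q h alpha r x)
  (dlaw : dual_law P N g Qs hs alpha rs y).
Variables (e c1 t a : R).
Hypotheses (e1 : `|e| <= 1) (c1_ge : ln kappa <= c1).
Let S w n : R := e * walk h x n w.
Let Ss w n : R := e * walk hs y n w.
Local Notation C := (comparison_constant kappa alpha m M).

Let C_gt0 : 0 < C.
Proof.
apply: lt_le_trans (ltr01) _.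
exact: (comparison_constant_ge1 FK alpha_ge0 m_gt0 r_bounds sx).
Qed.

Lemma ladder_visits_le_visits :
  (C^-1%:E * \int[Qs]_w ladder_visits (ladder_plus (Ss w))
     `[(t + c1)%R, (t + a - c1)%R] (Ss w)
   <= \int[Q]_w visits_before (tau_minus c1 (S w)) `[t, (t + a)%R] (S w))%E.
Proof.
have [mh _] := law; have [mhs _] := dlaw.
apply: lee_inv_pmull => //; rewrite integral_visits// integral_ladder_visits//.
apply: le_esum_natZ; first exact: ltW.
  by move=> n; apply: integral_ge0 => w _; rewrite lee_fin.
move=> n; apply: (dual_original_le d_gt0 brw mGamma Gamma_carries FK Gamma_mul
  Gamma_allowable alpha_ge0 m_gt0 r_bounds rs_bounds sx sy law dlaw).
- exact: measurable_stay_event.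
- exact: measurable_record_event.
- by move=> s sG; exact: (record_stay FK Gamma_mul Gamma_allowable e1 c1_ge).
Qed.

Lemma visits_le_ladder_visits :
  (\int[Q]_w visits_before (tau_minus (- c1) (S w)) `[t, (t + a)%R] (S w)
   <= C%:E * \int[Qs]_w ladder_visits (ladder_plus (Ss w))
     `[(t - c1)%R, (t + a + c1)%R] (Ss w))%E.
Proof.
have [mh _] := law; have [mhs _] := dlaw.
rewrite integral_visits// integral_ladder_visits//.
apply: le_esum_natZ; first exact: ltW.
  by move=> n; apply: integral_ge0 => w _; rewrite lee_fin.
move=> n; apply: (original_dual_le d_gt0 brw mGamma Gamma_carries FK Gamma_mul
  Gamma_allowable alpha_ge0 m_gt0 r_bounds rs_bounds sx sy law dlaw).
- exact: measurable_stay_event.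
- exact: measurable_record_event.
- by move=> s sG; exact: (stay_record FK Gamma_mul Gamma_allowable e1 c1_ge).
Qed.

End Inequalities.

(** The semigroup is the intersection of its closure with the matrices whose entries
    are positive: these are allowable, and it is closed among the allowable ones. *)
Lemma measurable_smallest_semigroup (R : realType) (d : nat)
    (disp : measure_display) (Omega : measurableType disp) (P : probability Omega R)
    (N : seq nat -> Omega -> enat) (g : seq nat -> Omega -> 'M[R]_d)
    (Gamma : set 'M[R]_d) (kappa : R) : (0 < d)%N ->
  smallest_semigroup P N g (@allowable R d) Gamma -> furstenberg_kesten kappa Gamma ->
  measurable (Gamma : set (borel_mx R d)).
Proof.
move=> d0 [[Gal _ Gcl] _ _] [_ FK].
have -> : (Gamma : set (borel_mx R d)) = closure Gamma `&`
    \bigcap_(i in [set: 'I_d]) \bigcap_(j in [set: 'I_d])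
      (fun A : borel_mx R d => (A : 'M[R]_d) i j) @^-1` `]0, +oo[%classic.
  apply/seteqP; split=> [A GA|A [clA A0]].
    split; first exact: subset_closure.
    by move=> i _ j _; rewrite /= in_itv /= andbT; exact: (FK A GA).1.
  have {}A0 i j : 0 < (A : 'M[R]_d) i j.
    by have := A0 i Logic.I j Logic.I; rewrite /= in_itv /= andbT.
  apply: Gcl; split=> //; split=> [i j|i|j]; first exact: ltW.
  - by exists (Ordinal d0).
  - by exists (Ordinal d0).
apply: measurableI; first by apply: measurable_closed_mx; exact: closed_closure.
apply: fin_bigcap_measurable => // i _; apply: fin_bigcap_measurable => // j _.
by rewrite -[X in measurable X]setTI; apply: measurable_entry.
Qed.

(** * The duality inequalities *)

Theorem lemma7p5
  (R : realType) (d : nat) (hd : (0 < d)%N)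
  (disp : measure_display) (Omega : measurableType disp)
  (P : probability Omega R)
  (N : seq nat -> Omega -> enat) (g : seq nat -> Omega -> 'M[R]_d)
  (hbrw : matrix_brw P N g)
  (Gamma : set 'M[R]_d)
  (hGamma : smallest_semigroup P N g (@allowable R d) Gamma)
  (kappa : R) (hFK : furstenberg_kesten kappa Gamma)
  (alpha : R) (hbc : boundary_case P N g alpha)
  (r rs : 'cV[R]_d -> R)
  (hr : positive_eigenfunction (transfer P N g alpha) (m_radius P N g alpha) r)
  (hrs : positive_eigenfunction (transfer_dual P N g alpha) (m_radius P N g alpha) rs)
  (c0 : R) (hc0 : 0 < c0)
  (hc0Gamma : forall k, Gamma k -> forall x x' : 'cV[R]_d,
     sphere x -> sphere x' ->
     `|ln (vnorm (k *m x)) - ln (vnorm (k *m x'))| <= c0) :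
  let c1 : R := c0 + 2 * ln kappa + ln d%:R in
  exists c C : R, 0 < c /\ 0 < C /\
  forall (x y : 'cV[R]_d) (t a : R), sphere x -> sphere y -> 0 <= a ->
  forall (disp1 : measure_display) (Omega1 : measurableType disp1)
    (Q : probability Omega1 R) (h : nat -> Omega1 -> 'M[R]_d)
    (disp2 : measure_display) (Omega2 : measurableType disp2)
    (Qs : probability Omega2 R) (hs : nat -> Omega2 -> 'M[R]_d),
  original_law P N g Q h alpha r x ->
  dual_law P N g Qs hs alpha rs y ->
  let S_ (w : Omega1) : nat -> R := fun n => walk h x n w in
  let Sopp (w : Omega1) : nat -> R := fun n => - walk h x n w in
  let Ss (w : Omega2) : nat -> R := fun n => walk hs y n w in
  let Ssopp (w : Omega2) : nat -> R := fun n => - walk hs y n w in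
  [/\ (c%:E * \int[Qs]_w ladder_visits (ladder_plus (Ss w))
                 `[(t + c1)%R, (t + a - c1)%R] (Ss w)
       <= \int[Q]_w visits_before (tau_minus c1 (S_ w))
                 `[t, (t + a)%R] (S_ w))%E,
      (\int[Q]_w visits_before (tau_minus (- c1) (S_ w))
                 `[t, (t + a)%R] (S_ w)
       <= C%:E * \int[Qs]_w ladder_visits (ladder_plus (Ss w))
                 `[(t - c1)%R, (t + a + c1)%R] (Ss w))%E,
      (c%:E * \int[Qs]_w ladder_visits (ladder_minus (Ss w))
                 `[(t + c1)%R, (t + a - c1)%R] (Ssopp w)
       <= \int[Q]_w visits_before (tau_plus c1 (S_ w))
                 `[t, (t + a)%R] (Sopp w))%E &
      (\int[Q]_w visits_before (tau_plus (- c1) (S_ w))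
                 `[t, (t + a)%R] (Sopp w)
       <= C%:E * \int[Qs]_w ladder_visits (ladder_minus (Ss w))
                 `[(t - c1)%R, (t + a + c1)%R] (Ssopp w))%E].
Proof.
move=> c1.
have [[Gal Gmul _] Gcarries _] := hGamma.
have mGamma := measurable_smallest_semigroup hd hGamma hFK.
have [cr r0 _] := hr; have [crs rs0 _] := hrs.
have [m1 [M1 [m10 M10 r_bd]]] := sphere_bounds cr r0.
have [m2 [M2 [m20 M20 rs_bd]]] := sphere_bounds crs rs0.
pose m := Num.min m1 m2; pose M := Num.max M1 M2.
have m0 : 0 < m by rewrite lt_min m10 m20.
have r_bounds x : sphere x -> m <= r x <= M.
  by move=> /r_bd/andP[lo up]; rewrite ge_min lo le_max up.
have rs_bounds x : sphere x -> m <= rs x <= M.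
  by move=> /rs_bd/andP[lo up]; rewrite ge_min lo le_max up !orbT.
have alpha0 : 0 <= alpha by have [_ [/interior_subset[]]] := hbc.
have kappa1 := hFK.1.
have c1_ge : ln kappa <= c1.
  have lnk : 0 <= ln kappa by rewrite ln_ge0// ltW.
  have lnd : 0 <= ln (d%:R : R) by rewrite ln_ge0// ler1n.
  by rewrite /c1; move: hc0 lnk lnd; lra.
pose C := comparison_constant kappa alpha m M.
have C0 : 0 < C.
  rewrite /C /comparison_constant; have M0 : 0 < M by rewrite lt_max M10.
  by rewrite mulr_gt0 ?divr_gt0 ?mulr_gt0 ?expR_gt0.
exists C^-1, C; split; first by rewrite invr_gt0.
split=> // x y t a sx sy a0 disp1 Omega1 Q h disp2 Omega2 Qs hs law dlaw.
move=> S_ Sopp Ss Ssopp.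
pose lower e (e1 : `|e| <= 1) := @ladder_visits_le_visits R d hd disp Omega P N g hbrw
  Gamma kappa alpha m M r rs mGamma Gcarries hFK Gmul Gal alpha0 m0 r_bounds rs_bounds
  x y sx sy disp1 Omega1 Q h disp2 Omega2 Qs hs law dlaw e c1 t a e1 c1_ge.
pose upper e (e1 : `|e| <= 1) := @visits_le_ladder_visits R d hd disp Omega P N g hbrw
  Gamma kappa alpha m M r rs mGamma Gcarries hFK Gmul Gal alpha0 m0 r_bounds rs_bounds
  x y sx sy disp1 Omega1 Q h disp2 Omega2 Qs hs law dlaw e c1 t a e1 c1_ge.
(* The ascending case is e = 1, the descending one e = -1. *)
have e1 : `|1 : R| <= 1 by rewrite normr1.
have eN1 : `|-1 : R| <= 1 by rewrite normrN1.
have S1 w : S_ w = (fun n => 1 * walk h x n w) by apply/funext => n; rewrite mul1r.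
have Ss1 w : Ss w = (fun n => 1 * walk hs y n w) by apply/funext => n; rewrite mul1r.
have SN w : Sopp w = (fun n => -1 * walk h x n w) by apply/funext => n; rewrite mulN1r.
have SsN w : Ssopp w = (fun n => -1 * walk hs y n w) by apply/funext => n; rewrite mulN1r.
have tauE b w : tau_plus b (S_ w) = tau_minus b (Sopp w) by exact: tau_plus_opp.
have ladE w : ladder_minus (Ss w) = ladder_plus (Ssopp w) by exact: ladder_minus_opp.
split.
- under eq_integral do rewrite Ss1.
  under [X in (_ <= X)%E]eq_integral do rewrite S1.
  exact: lower e1.
- under eq_integral do rewrite S1.
  under [X in (_ <= _ * X)%E]eq_integral do rewrite Ss1.
  exact: upper e1.
- under eq_integral do rewrite ladE SsN.
  under [X in (_ <= X)%E]eq_integral do rewrite tauE SN.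
  exact: lower eN1.
- under eq_integral do rewrite tauE SN.
  under [X in (_ <= _ * X)%E]eq_integral do rewrite ladE SsN.
  exact: upper eN1.
Qed.
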